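(* Assume (A1)–(A3) of the context. Then, for a given initial state $x_0$, a trajectory that satisfies the Minimum Principle from $x_0$ is the unique global minimum of the deterministic optimal control problem starting at the initial state $x_0$.
   Context: Deterministic optimal control problem: minimize $\int_0^Tc(x_t,u_t)\,dt+c_T(x_T)$ subject to $\dot x=f(x)+g(x)u$, $x(0)=x_0$, with $x\in\mathbb{R}^{n_x}$, $u\in\mathbb{R}^{n_u}$ and finite horizon $T$. Assumptions. (A1) $c(x,u)=l(x)+\frac12u^{\mathsf T}Ru$ with $R$ positive definite. (A2) $f,g,l,c_T$ are five times continuously differentiable. (A3) The HJB equation has a smooth solution: there exists a continuously differentiable function $\phi(t,x)$ satisfying the deterministic HJB equation $-\partial_t\phi=\min_u\{l(x)+\frac12u^{\mathsf T}Ru+(\partial_x\phi)^{\mathsf T}(f(x)+g(x)u)\}$ with $\phi(T,x)=c_T(x)$. (A3 also asks for a $\mathcal C^2$ solution of the stochastic HJB equation, obtained by adding $\frac{\epsilon^2}{2}\sum_{i,j}Q_{ij}\,\partial^2 J/\partial x_i\partial x_j$ to the right-hand side, where $Q=[Q_{ij}]$ is the noise covariance and $\epsilon$ the noise parameter; the present statement concerns the deterministic problem.) A trajectory satisfies the Minimum Principle from $x_0$ if there is a co-state $q(t)$, $t\in[0,T]$, such that, with $\mathcal{H}(x,q,u)=l(x)+\frac12u^{\mathsf T}Ru+q^{\mathsf T}(f(x)+g(x)u)$: $u_t=-R^{-1}g(x_t)^{\mathsf T}q_t$ (the minimizer of $\mathcal{H}(x_t,q_t,\cdot)$), $\dot x=\partial_q\mathcal{H}(x,q,u)=f(x)+g(x)u$,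 $\dot q=-\partial_x\mathcal{H}(x,q,u)$, $x(0)=x_0$, and $q(T)=\nabla c_T(x(T))$. In the scalar case with $R=r$ these are $\dot x=f(x)-\frac{g(x)^2}{r}q$ and $\dot q=-l'(x)+\frac{g(x)g'(x)}{r}q^2-f'(x)q$. *)

(* Defs.v *)
From HB Require Import structures.
From mathcomp Require Import all_boot all_order all_algebra.
From mathcomp Require Import all_classical all_reals all_analysis.

Set Implicit Arguments.
Unset Strict Implicit.
Unset Printing Implicit Defensive.

Import Order.TTheory GRing.Theory Num.Theory.
Import numFieldNormedType.Exports.

Local Open Scope classical_set_scope.
Local Open Scope ring_scope.

Section Calculus.
Context {R : realType}.

(* Class C^k.  In finite dimension, continuity of x |-> 'D_v F x for every
   direction v is the same as continuity of x |-> 'd F x. *)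
Fixpoint class_C (k : nat) (V W : normedModType R) (F : V -> W) : Prop :=
  if k is k'.+1
  then (forall x, differentiable F x) /\
       (forall v, class_C k' (fun x => 'D_v F x))
  else continuous F.

Definition grad (n : nat) (F : 'cV[R]_n -> R) (x : 'cV[R]_n) : 'cV[R]_n :=
  \col_i 'D_(delta_mx i 0) F x.

Definition posdef (n : nat) (A : 'M[R]_n) : Prop :=
  A^T = A /\ forall v : 'cV[R]_n, v != 0 -> 0 < (v^T *m A *m v) 0 0.

Definition is_min (A : set R) (m : R) : Prop := A m /\ lbound A m.

(* Class C^1 on the closed slab [0, T] x R^n: differentiable in the interior,
   with the function and its partial derivatives having continuous extensions
   to the slab.  Values outside of the slab are irrelevant. *)
Definition C1_slab (n : nat) (T : R) (phi : R -> 'cV[R]_n -> R) : Prop :=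
  let slab : set (R * 'cV[R]_n) := `[0, T] `*` setT in
  {within slab, continuous (fun z : R * 'cV[R]_n => phi z.1 z.2)} /\
  (forall (t : R) x, t \in `]0, T[ ->
     differentiable (fun z : R * 'cV[R]_n => phi z.1 z.2) (t, x)) /\
  exists (phit : R * 'cV[R]_n -> R) (phix : R * 'cV[R]_n -> 'cV[R]_n),
    {within slab, continuous phit} /\ {within slab, continuous phix} /\
    forall (t : R) x, t \in `]0, T[ ->
      'D_1 (phi ^~ x) t = phit (t, x) /\ grad (phi t) x = phix (t, x).

End Calculus.

(* Minimize  \int_0^T c(x, u) dt + c_T(x_T)  with  c(x, u) = l(x) + u^T R u / 2,
   subject to  dx/dt = f(x) + g(x) u. *)
Record control_problem (R : realType) (nx nu : nat) := ControlProblem {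
  drift : 'cV[R]_nx -> 'cV[R]_nx;                (* f *)
  input_gain : 'cV[R]_nx -> 'M[R]_(nx, nu);      (* g *)
  state_cost : 'cV[R]_nx -> R;                   (* l *)
  control_weight : 'M[R]_nu;                     (* R *)
  terminal_cost : 'cV[R]_nx -> R;                (* c_T *)
  horizon : R                                    (* T *)
}.

Section OptimalControl.
Context {R : realType} {nx nu : nat}.
Variable P : control_problem R nx nu.
Local Notation T := (horizon P).
Local Notation mu := (@lebesgue_measure R).

Definition running_cost (x : 'cV[R]_nx) (u : 'cV[R]_nu) : R :=
  state_cost P x + 2^-1 * (u^T *m control_weight P *m u) 0 0.

Definition velocity (x : 'cV[R]_nx) (u : 'cV[R]_nu) : 'cV[R]_nx :=
  drift P x + input_gain P x *m u.

Definition hamiltonian (x q : 'cV[R]_nx) (u : 'cV[R]_nu) : R :=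
  running_cost x u + (q^T *m velocity x u) 0 0.

Definition smooth_data : Prop :=
  [/\ class_C 5 (drift P), class_C 5 (input_gain P),
      class_C 5 (state_cost P) & class_C 5 (terminal_cost P)].

(* phi is C^1 up to t = 0 and t = T, so that the equation on ]0, T[ is the
   equation on [0, T] with one-sided time derivatives at the end points. *)
Definition HJB_solution (phi : R -> 'cV[R]_nx -> R) : Prop :=
  [/\ C1_slab T phi,
      (forall (t : R) x, t \in `]0, T[ ->
         is_min (range (hamiltonian x (grad (phi t) x)))
                (- 'D_1 (phi ^~ x) t))
    & (forall x, phi T x = terminal_cost P x)].

(* Only the restrictions to [0, T] of the state x, the control u and the
   co-state q matter.  The differential equations are required on ]0, T[;
   continuity of x and q on [0, T] makes them hold at the end points as well,
   for one-sided derivatives. *)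
Definition minimum_principle (x0 : 'cV[R]_nx)
    (x : R -> 'cV[R]_nx) (u : R -> 'cV[R]_nu) : Prop :=
  exists q : R -> 'cV[R]_nx,
    {within `[0, T], continuous x} /\
    {within `[0, T], continuous q} /\
    (forall t : R, t \in `[0, T] ->
       u t = - (invmx (control_weight P) *m (input_gain P (x t))^T *m q t)) /\
    (forall t : R, t \in `]0, T[ -> is_derive t 1 x (velocity (x t) (u t))) /\
    (forall t : R, t \in `]0, T[ ->
       is_derive t 1 q (- grad (fun y => hamiltonian y (q t) (u t)) (x t))) /\
    x 0 = x0 /\
    q T = grad (terminal_cost P) (x T).

(* Admissible controls are the measurable square-integrable ones, i.e. those
   of finite cost since R is positive definite; the dynamics are then
   understood in integral form. *)
Definition admissible (x0 : 'cV[R]_nx)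
    (x : R -> 'cV[R]_nx) (u : R -> 'cV[R]_nu) : Prop :=
  [/\ (forall i, measurable_fun `[0, T] (fun t => u t i 0)),
      (forall i, mu.-integrable `[0, T] (fun t => ((u t i 0) ^+ 2)%:E)),
      {within `[0, T], continuous x}
    & (forall (t : R) i, t \in `[0, T] ->
         x t i 0 = x0 i 0 + \int[mu]_(s in `[0, t]) velocity (x s) (u s) i 0)].

Definition total_cost (x : R -> 'cV[R]_nx) (u : R -> 'cV[R]_nu) : R :=
  (\int[mu]_(t in `[0, T]) running_cost (x t) (u t)) + terminal_cost P (x T).

Definition global_minimum (x0 : 'cV[R]_nx)
    (x : R -> 'cV[R]_nx) (u : R -> 'cV[R]_nu) : Prop :=
  admissible x0 x u /\
  forall y v, admissible x0 y v -> total_cost x u <= total_cost y v.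

(* Measurable controls are identified when they agree almost everywhere. *)
Definition unique_global_minimum (x0 : 'cV[R]_nx)
    (x : R -> 'cV[R]_nx) (u : R -> 'cV[R]_nu) : Prop :=
  global_minimum x0 x u /\
  forall y v, global_minimum x0 y v ->
    (forall t : R, t \in `[0, T] -> y t = x t) /\
    {ae mu, forall t : R, t \in `[0, T] -> v t = u t}.

End OptimalControl.

(* Main.v *)
Require Import Defs.
From mathcomp Require Import all_boot all_order all_algebra.
From mathcomp Require Import all_classical all_reals all_analysis.
From mathcomp Require Import ring lra.

(* Let phi solve the HJB equation.  Along any admissible pair (y, v) the equation
   gives
     cost(y, v) = phi(0, x0) + int_0^T (v - w)^T R (v - w) / 2,
   where w = - R^-1 g^T (grad phi) is the feedback control; so (x, u) is optimal
   as soon as u is the feedback control along x, that is q = grad phi along x.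
   Since phi is only C^1, grad phi cannot be differentiated along a trajectory.
   Instead, translate a closed-loop trajectory y by a small constant h: the HJB
   inequality for the translated path, kept with the same control, is an equality
   for h = 0, and comparing first-order terms in h and - h shows that grad phi
   along y solves the integrated co-state equation.  The argument is robust: it
   works for Euler polygons, up to a small error.  Polygons built backwards from
   x(T) with the feedback control, together with grad phi along them, therefore
   nearly solve the same Cauchy problem, with locally Lipschitz right-hand side,
   as (x, q); letting the step go to 0 gives q = grad phi along x, without any
   existence theorem for the closed-loop equation.  For uniqueness, a second
   minimizer y has zero excess cost, hence is a closed-loop trajectory; (y, grad phi)
   and (x, q) then solve the same Cauchy problem from time 0. *)

Set Implicit Arguments.
Unset Strict Implicit.
Unset Printing Implicit Defensive.

Import Order.TTheory GRing.Theory Num.Theory.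
Import numFieldNormedType.Exports.
Local Open Scope classical_set_scope.
Local Open Scope ring_scope.

(** * Matrix norms and uniform continuity *)

Section MatrixNorm.
Context {R : realType}.

Lemma coord_le_norm m n (A : 'M[R]_(m, n)) i j : `|A i j| <= `|A|.
Proof.
rewrite [leRHS]/Num.norm /= mx_normrE; apply/bigmax_geP; right.
by exists (i, j).
Qed.

Lemma norm_le_coord m n (A : 'M[R]_(m, n)) e :
  0 <= e -> (forall i j, `|A i j| <= e) -> `|A| <= e.
Proof.
move=> e0 Ae; rewrite [leLHS]/Num.norm /= mx_normrE; apply/bigmax_leP.
by split => // -[i j] _; exact: Ae.
Qed.

Lemma norm_delta_mx_le m n (i : 'I_m) (j : 'I_n) :
  `|delta_mx i j : 'M[R]_(m, n)| <= 1.
Proof.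
apply: norm_le_coord => // k l; rewrite mxE.
by case: (_ && _); rewrite ?normr1 ?normr0.
Qed.

(** The norm is the maximum norm, so the ball is a product of segments. Compactness of such
    products, known for row vectors, is transported by the continuous transposition; a negative [M]
    gives the empty set. *)
Lemma compact_ball_cV n M : compact [set x : 'cV[R]_n | `|x| <= M].
Proof.
have cr : compact [set v : 'rV[R]_n | forall i, v ord0 i \in `[- M, M]].
  by apply: (@rV_compact _ _ (fun=> `[- M, M]%classic)) => _; exact: segment_compact.
have ct : continuous (@trmx R 1 n).
  move=> /= v s /= /(nbhs_ballP (v^T)) [e e0 es]; apply/nbhs_ballP; exists e => //=.
  move=> w [_ vw]; apply: es; split=> // i j; rewrite !mxE; exact: vw.
have ci : compact [set x^T | x in [set v : 'rV[R]_n | forall i, v ord0 i \in `[- M, M]]].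
  by apply: continuous_compact => //; exact: continuous_subspaceT.
have [M0|M0] := leP 0 M; last first.
  rewrite (_ : mkset _ = set0); first exact: compact0.
  rewrite predeqE => x; split => //= xM.
  by have := le_lt_trans xM M0; rewrite ltNge normr_ge0.
rewrite (_ : mkset _ = [set x^T | x in [set v : 'rV[R]_n | forall i, v ord0 i \in `[- M, M]]]) //.
rewrite predeqE => x; split => /=.
  move=> xM; exists x^T; rewrite ?trmxK // => i; rewrite mxE in_itv/= -ler_norml.
  exact: le_trans (coord_le_norm _ _ _) xM.
move=> [v vM <-]; apply: norm_le_coord => // i j; rewrite mxE (ord1 j).
by have := vM i; rewrite in_itv/= -ler_norml.
Qed.

End MatrixNorm.

(** * Continuity relative to a subset, and its uniform version on compact sets *)

Section UniformContinuity.
Context {R : realType}.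
Implicit Types V W : normedModType R.

Lemma within_continuousP V W (A : set V) (F : V -> W) :
  {within A, continuous F} <->
  forall z, A z -> forall e : R, 0 < e -> exists2 d : R, 0 < d &
    forall w, A w -> `|z - w| < d -> `|F z - F w| < e.
Proof.
have nbhsA z : A z -> nbhs (z : subspace A) = within A (nbhs (z : V)).
  by move=> Az; case: (nbhs_subspaceP A z).
split => [cF z Az e e0|cF z].
  have /(_ (ball (F z) e)) := cF z; rewrite /fmap /= nbhsA //.
  move=> /(_ (nbhsx_ballx _ _ e0)) /nbhs_ballP [d /= d0 dF].
  exists d => // w Aw zw; move: (dF w); rewrite -!ball_normE; exact.
(* Outside of [A] the subspace topology is discrete, so continuity there is automatic. *)
have [Az|nAz] := pselect (A z); last first.
  move=> B /nbhs_singleton Bz; rewrite /fmap /=.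
  by case: (nbhs_subspaceP A z) => // _ w /= ->.
move=> B /nbhs_ballP [e /= e0 eB]; rewrite /fmap /= nbhsA //.
have [d d0 dF] := cF z Az e e0.
apply/nbhs_ballP; exists d => //= w; rewrite -ball_normE /= => zw Aw.
by apply: eB; rewrite -ball_normE /=; exact: dF.
Qed.

(** Heine-Cantor theorem: in its near-covering form, compactness merges the local moduli at the
    points of [A] into a single [d]. *)
Lemma compact_unif_cont V W (A : set V) (F : V -> W) :
  compact A -> {within A, continuous F} -> forall e : R, 0 < e ->
  exists2 d : R, 0 < d & forall z w, A z -> A w -> `|z - w| <= d -> `|F z - F w| <= e.
Proof.
move=> /compact_near_coveringP cA /within_continuousP cF e e0.
have : \forall d \near 0^'+, A `<=` [set z | A z -> forall w, A w -> `|z - w| <= d -> `|F z - F w| <= e].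
  apply: cA => z Az.
  have e20 : 0 < e / 2 by rewrite divr_gt0.
  have [d d0 dF] := cF z Az _ e20.
  have d20 : 0 < d / 2 by rewrite divr_gt0.
  near=> z' d' => Az' w Aw z'w.
  have zz' : `|z - z'| < d / 2.
    by near: z'; apply/nbhs_ballP; exists (d / 2) => //= y; rewrite -ball_normE.
  have d'd : d' < d / 2 by near: d'; exact: nbhs_right_lt.
  rewrite [e]splitr -(subrKA (F z)); apply: le_trans (ler_normD _ _) _.
  apply: lerD.
    rewrite distrC; apply/ltW/dF => //; apply: lt_trans zz' _.
    by rewrite ltr_pdivrMr // ltr_pMr // ltr1n.
  apply/ltW/dF => //; rewrite -(subrKA z') [ltRHS]splitr.
  apply: le_lt_trans (ler_normD _ _) _; apply: ltrD => //.
  exact: le_lt_trans z'w d'd.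
move=> H; have [d [Ad d0]] : exists d, (A `<=` [set z | A z -> forall w, A w -> `|z - w| <= d -> `|F z - F w| <= e]) /\ 0 < d.
  near (0:R)^'+ => d; exists d; split; first by near: d.
  by near: d; exact: nbhs_right_gt.
by exists d => // z w Az; exact: Ad.
Unshelve. all: by end_near.
Qed.

Lemma compact_bound V W (A : set V) (F : V -> W) :
  compact A -> {within A, continuous F} ->
  exists2 B : R, 0 < B & forall z, A z -> `|F z| <= B.
Proof.
move=> cA cF; have [M [_ MF]] := compact_bounded (continuous_compact cF cA).
exists (Num.max M 0 + 1); first by rewrite ltr_wpDl // le_max lexx orbT.
move=> z Az; apply: (MF (Num.max M 0 + 1)); last by exists z.
by rewrite ltr_pwDr // le_max lexx.
Qed.

End UniformContinuity.

(** * Locally Lipschitz maps and mean value inequalities *)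
Section LocallyLipschitz.
Context {R : realType}.
Implicit Types U V W : normedModType R.

(** Lipschitz on each bounded set. A global Lipschitz bound would not survive products, and the
    Hamiltonian is quadratic in the control; this property is stable under products and
    composition. *)
Definition ball_lip V W (F : V -> W) := forall M : R, exists2 L : R, 0 <= L &
  forall z w, `|z| <= M -> `|w| <= M -> `|F z - F w| <= L * `|z - w|.

Lemma ball_lip_bound V W (F : V -> W) (M : R) : ball_lip F ->
  exists2 B : R, 0 < B & forall z, `|z| <= M -> `|F z| <= B.
Proof.
(* The absolute value of [M] puts 0 into the ball even when [M] is negative. *)
move=> /(_ `|M|) [L L0 FL]; exists (`|F 0| + L * `|M| + 1).
  by rewrite ltr_wpDl // addr_ge0 // mulr_ge0.
move=> z zM; have zM' : `|z| <= `|M| := le_trans zM (ler_norm M).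
have := FL z 0 zM'; rewrite normr0 subr0 => /(_ (normr_ge0 _)) FzL.
apply: (@le_trans _ _ (`|F 0| + L * `|M|)); last by rewrite lerDl.
rewrite -[F z](subrK (F 0)) addrC (le_trans (ler_normD _ _)) // lerD2l.
by apply: le_trans FzL _; exact: ler_wpM2l.
Qed.

Lemma ball_lip_cst V W (c : W) : ball_lip (fun _ : V => c).
Proof. by move=> M; exists 0 => // z w _ _; rewrite subrr normr0 mul0r. Qed.

Lemma ball_lip_id V : ball_lip (fun x : V => x).
Proof. by move=> M; exists 1 => // z w _ _; rewrite mul1r. Qed.

Lemma ball_lip_comp U V W (F : V -> W) (G : U -> V) :
  ball_lip F -> ball_lip G -> ball_lip (fun x => F (G x)).
Proof.
move=> hF hG M; have [B B0 GB] := ball_lip_bound M hG.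
have [L L0 FL] := hF B; have [K K0 GK] := hG M.
exists (L * K); first exact: mulr_ge0.
move=> z w zM wM; apply: le_trans (FL _ _ (GB _ zM) (GB _ wM)) _.
by rewrite -mulrA ler_wpM2l // GK.
Qed.

Lemma prod_normE V W (z : V * W) : `|z| = Num.max `|z.1| `|z.2|.
Proof. by []. Qed.

Lemma ball_lip_fst V W : ball_lip (@fst V W).
Proof. by move=> M; exists 1 => // z w _ _; rewrite mul1r prod_normE le_max lexx. Qed.

Lemma ball_lip_snd V W : ball_lip (@snd V W).
Proof. by move=> M; exists 1 => // z w _ _; rewrite mul1r prod_normE le_max lexx orbT. Qed.

Lemma ball_lip_pair U V W (F : U -> V) (G : U -> W) :
  ball_lip F -> ball_lip G -> ball_lip (fun x => (F x, G x)).
Proof.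
move=> hF hG M; have [L L0 FL] := hF M; have [K K0 GK] := hG M.
exists (Num.max L K) => [|z w zM wM]; first by rewrite le_max L0.
rewrite prod_normE /= ge_max; apply/andP; split.
  by apply: le_trans (FL _ _ zM wM) _; rewrite ler_wpM2r // le_max lexx.
by apply: le_trans (GK _ _ zM wM) _; rewrite ler_wpM2r // le_max lexx orbT.
Qed.

Lemma ball_lipD V W (F G : V -> W) : ball_lip F -> ball_lip G -> ball_lip (fun x => F x + G x).
Proof.
move=> hF hG M; have [L L0 FL] := hF M; have [K K0 GK] := hG M.
exists (L + K) => [|z w zM wM]; first exact: addr_ge0.
rewrite opprD addrACA mulrDl (le_trans (ler_normD _ _)) //.
by rewrite lerD ?FL ?GK.
Qed.

Lemma ball_lipN V W (F : V -> W) : ball_lip F -> ball_lip (fun x => - F x).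
Proof.
move=> hF M; have [L L0 FL] := hF M; exists L => // z w zM wM.
by rewrite -opprD normrN FL.
Qed.

Lemma ball_lipM V (F G : V -> R) : ball_lip F -> ball_lip G -> ball_lip (fun x => F x * G x).
Proof.
move=> hF hG M; have [L L0 FL] := hF M; have [K K0 GK] := hG M.
have [B B0 FB] := ball_lip_bound M hF; have [C C0 GC] := ball_lip_bound M hG.
exists (B * K + L * C) => [|z w zM wM].
  by rewrite addr_ge0 // mulr_ge0 // ltW.
rewrite (_ : _ - _ = F z * (G z - G w) + (F z - F w) * G w); last first.
  by rewrite mulrBr mulrBl addrA subrK.
rewrite [leRHS]mulrDl; apply: le_trans (ler_normD _ _) _; apply: lerD; rewrite normrM.
  by rewrite -mulrA ler_pM // ?FB // GK.
by rewrite mulrAC ler_pM // ?GC // FL.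
Qed.

Lemma ball_lip_sum V W (I : finType) (F : I -> V -> W) :
  (forall i, ball_lip (F i)) -> ball_lip (fun x => \sum_i F i x).
Proof.
move=> hF; pose G (s : seq I) x := \sum_(i <- s) F i x.
suff : ball_lip (G (index_enum I)) by [].
elim: (index_enum I) => [|i s IH] M.
  have [L L0 GL] := @ball_lip_cst V W 0 M; exists L => // z w zM wM.
  by rewrite /G !big_nil; exact: GL.
have [L L0 GL] := ball_lipD (hF i) IH M; exists L => // z w zM wM.
by rewrite /G !big_cons; exact: GL.
Qed.

Lemma ball_lip_coord V m n (F : V -> 'M[R]_(m, n)) i j :
  ball_lip F -> ball_lip (fun x => F x i j).
Proof.
move=> hF M; have [L L0 FL] := hF M; exists L => // z w zM wM.
apply: le_trans (FL z w zM wM).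
by have := coord_le_norm (F z - F w) i j; rewrite !mxE.
Qed.

Lemma ball_lip_mx V m n (F : V -> 'M[R]_(m, n)) :
  (forall i j, ball_lip (fun x => F x i j)) -> ball_lip F.
Proof.
move=> hF M; have /choice [L hL] : forall ij : 'I_m * 'I_n, exists L, 0 <= L /\
    forall z w, `|z| <= M -> `|w| <= M -> `|F z ij.1 ij.2 - F w ij.1 ij.2| <= L * `|z - w|.
  by move=> [i j]; have [L L0 FL] := hF i j M; exists L.
exists (\sum_ij L ij); first by apply: sumr_ge0 => ij _; case: (hL ij).
move=> z w zM wM; apply: norm_le_coord => [|i j].
  by rewrite mulr_ge0 // sumr_ge0 // => ij _; case: (hL ij).
have [Lij FL] := hL (i, j); rewrite !mxE (le_trans (FL z w zM wM)) // ler_wpM2r //.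
by rewrite (bigD1 (i, j)) //= lerDl sumr_ge0 // => ij _; case: (hL ij).
Qed.

Lemma ball_lip_tr V m n (F : V -> 'M[R]_(m, n)) : ball_lip F -> ball_lip (fun x => (F x)^T).
Proof.
move=> hF; apply: ball_lip_mx => i j; have := ball_lip_coord j i hF.
by move=> h M; have [L L0 FL] := h M; exists L => // z w zM wM; rewrite !mxE FL.
Qed.

Lemma ball_lip_mulmx V m n p (F : V -> 'M[R]_(m, n)) (G : V -> 'M[R]_(n, p)) :
  ball_lip F -> ball_lip G -> ball_lip (fun x => F x *m G x).
Proof.
move=> hF hG; apply: ball_lip_mx => i j.
have h : ball_lip (fun x => \sum_k F x i k * G x k j).
  by apply: ball_lip_sum => k; apply: ball_lipM; exact: ball_lip_coord.
by move=> M; have [L L0 FL] := h M; exists L => // z w zM wM; rewrite !mxE FL.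
Qed.

Lemma ball_lip_ext V W (F G : V -> W) : (forall x, F x = G x) -> ball_lip F -> ball_lip G.
Proof. by move=> /funext ->. Qed.

End LocallyLipschitz.

(** * Maps of class C^k: lower orders and coordinates *)

Section ClassC.
Context {R : realType}.
Implicit Types V W : normedModType R.

Lemma class_C_weaken V W k (F : V -> W) : class_C k.+1 F -> class_C k F.
Proof.
elim: k F => [F [dF _] x|k IH F [dF CF]]; first exact: differentiable_continuous.
by split => // v; apply/IH/CF.
Qed.

Lemma class_C_le V W k j (F : V -> W) : (j <= k)%N -> class_C k F -> class_C j F.
Proof.
move=> jk; rewrite -(subnK jk); elim: (k - j)%N => // i IH; rewrite addSn.
by move=> /class_C_weaken.
Qed.

Lemma differentiable_mx_coord V m n (F : V -> 'M[R]_(m, n)) i j x :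
  differentiable F x -> differentiable (fun x => F x i j) x.
Proof.
move=> dF; exact: (differentiable_comp dF (differentiable_coord _ i j)).
Qed.

Lemma class_C_coord V m n k (F : V -> 'M[R]_(m, n)) i j :
  class_C k F -> class_C k (fun x => F x i j).
Proof.
elim: k F => [F cF x|k IH F [dF CF]].
  exact: (continuous_comp (cF x) (@coord_continuous _ _ _ i j _)).
split => [x|v]; first exact: differentiable_mx_coord.
rewrite (_ : (fun x => _) = (fun x => 'D_v F x i j)); first by apply: IH; exact: CF.
apply/funext => x; rewrite derive_mx ?mxE //.
exact/diff_derivable.
Qed.

End ClassC.

Section MeanValue.
Context {R : realType}.
Implicit Types U V W : normedModType R.

Lemma is_diff_ray V (z v : V) (s : R) :
  is_diff s (fun s : R => z + s *: v) (fun t : R => t *: v).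
Proof.
have := is_diffD (is_diff_cst z s) (is_diff_scalel s v).
by rewrite add0r.
Qed.

Lemma is_derive_ray V (F : V -> R) (z v : V) (s : R) :
  differentiable F (z + s *: v) ->
  is_derive s 1 (fun s : R => F (z + s *: v)) ('D_v F (z + s *: v)).
Proof.
move=> dF; have h := is_diff_comp (is_diff_ray z v s) (differentiableP dF).
apply: DeriveDef; first by apply: diff_derivable; case: h.
rewrite deriveE; last by case: h.
by case: h => _ ->; rewrite /= scale1r deriveE.
Qed.

Lemma within_continuous_comp U V W (A : set V) (B : set U) (F : V -> W) (g : U -> V) :
  {within A, continuous F} -> {within B, continuous g} -> (forall x, B x -> A (g x)) ->
  {within B, continuous (fun x => F (g x))}.
Proof.
move=> /within_continuousP cF /within_continuousP cg gBA.
apply/within_continuousP => z Bz e e0.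
have [d d0 dF] := cF _ (gBA _ Bz) _ e0; have [c c0 cG] := cg _ Bz _ d0.
by exists c => // w Bw zw; apply: dF; [exact: gBA|exact: cG].
Qed.

(** Differentiability is asked on the open segment and continuity on the closed one, so that the end
    points may lie on the boundary of the time slab. *)
Lemma MVT_ray V (A : set V) (F : V -> R) (z v : V) :
  {within A, continuous F} ->
  (forall s, 0 <= s <= 1 -> A (z + s *: v)) ->
  (forall s, 0 < s < 1 -> differentiable F (z + s *: v)) ->
  exists2 s : R, 0 < s < 1 & F (z + v) - F z = 'D_v F (z + s *: v).
Proof.
move=> cF zvA dF; pose G (s : R) := F (z + s *: v).
have dG (s : R) : s \in `]0, 1[ -> is_derive s 1 G ('D_v F (z + s *: v)).
  by rewrite in_itv /= => s01; apply: is_derive_ray; exact: dF.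
have cG : {within `[0, 1], continuous G}.
  apply: (within_continuous_comp cF) => [|s]; last by rewrite /= in_itv; exact: zvA.
  apply: continuous_subspaceT => s; apply: differentiable_continuous.
  by case: (is_diff_ray z v s).
have [s] := MVT (@ltr01 R) dG cG.
rewrite in_itv /= subr0 mulr1 /G scale0r addr0 scale1r => s01 ->.
by exists s.
Qed.

Lemma norm_ray_le V (z w : V) (s M : R) : 0 <= s <= 1 -> `|z| <= M -> `|w| <= M ->
  `|w + s *: (z - w)| <= M.
Proof.
move=> /andP[s0 s1] zM wM; rewrite -subr_ge0 in s1.
rewrite (_ : _ + _ = (1 - s) *: w + s *: z); last first.
  by rewrite scalerBr scalerBl scale1r addrAC addrA.
apply: le_trans (ler_normD _ _) _; rewrite !normrZ (ger0_norm s0) (ger0_norm s1).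
have := ler_wpM2l s0 zM; have := ler_wpM2l s1 wM; lra.
Qed.

Lemma derive_cV n (F : 'cV[R]_n -> R) (x v : 'cV[R]_n) : differentiable F x ->
  'D_v F x = \sum_i v i 0 * 'D_(delta_mx i 0) F x.
Proof.
move=> dF; rewrite deriveE //.
have {1}-> : v = \sum_i v i 0 *: delta_mx i 0.
  rewrite [LHS]matrix_sum_delta; apply: eq_bigr => i _.
  by rewrite big_ord_recl big_ord0 addr0.
rewrite linear_sum; apply: eq_bigr => i _.
by rewrite linearZ deriveE.
Qed.

(** The ball is convex and the partial derivatives, being continuous, are bounded on it by
    compactness; the mean value theorem on segments then gives the constant. *)
Lemma ball_lip_C1_scalar n (F : 'cV[R]_n -> R) : class_C 1 F -> ball_lip F.
Proof.
move=> [dF cF] M.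
have /choice [B hB] : forall i : 'I_n, exists B : R, 0 < B /\
    forall x, `|x| <= M -> `|'D_(delta_mx i 0) F x| <= B.
  move=> i; have [B B0 FB] := compact_bound (@compact_ball_cV R n M)
    (continuous_subspaceT (cF (delta_mx i 0))).
  by exists B.
exists (\sum_i B i) => [|z w zM wM].
  by apply: sumr_ge0 => i _; case: (hB i) => /ltW.
have cF0 : {within setT, continuous F}.
  by apply: continuous_subspaceT => x; exact: differentiable_continuous.
have [||s s01] := MVT_ray (z := w) (v := z - w) cF0; [by []|by []|].
rewrite subrKC => ->.
have sM : `|w + s *: (z - w)| <= M.
  by apply: norm_ray_le => //; case/andP: s01 => /ltW-> /ltW.
rewrite derive_cV // mulr_suml; apply: le_trans (ler_norm_sum _ _ _) _.
apply: ler_sum => i _; rewrite normrM mulrC; have [_ FB] := hB i.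
apply: ler_pM => //; first exact: FB.
have := coord_le_norm (z - w) i 0; exact.
Qed.

Lemma ball_lip_C1 m n p (F : 'cV[R]_n -> 'M[R]_(m, p)) : class_C 1 F -> ball_lip F.
Proof.
by move=> cF; apply: ball_lip_mx => i j; apply/ball_lip_C1_scalar/class_C_coord.
Qed.

End MeanValue.

(** * The Hamiltonian and the feedback control *)
Section Dot.
Context {R : realType} {n : nat}.
Implicit Types p w : 'cV[R]_n.

Definition dot p w : R := (p^T *m w) 0 0.

Lemma dotE p w : dot p w = \sum_i p i 0 * w i 0.
Proof. by rewrite /dot mxE; apply: eq_bigr => i _; rewrite mxE. Qed.

Lemma dotBr p w w' : dot p (w - w') = dot p w - dot p w'.
Proof. by rewrite /dot mulmxBr !mxE. Qed.

Lemma dotBl p p' w : dot (p - p') w = dot p w - dot p' w.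
Proof. by rewrite /dot linearB /= mulmxBl !mxE. Qed.

Lemma dotZr p a w : dot p (a *: w) = a * dot p w.
Proof. by rewrite /dot -scalemxAr mxE. Qed.

Lemma dot_delta p i : dot p (delta_mx i 0) = p i 0.
Proof.
rewrite dotE (bigD1 i) //= mxE !eqxx mulr1 big1 ?addr0 // => j ji.
by rewrite mxE (negbTE ji) mulr0.
Qed.

Lemma dot_norm_le p w : `|dot p w| <= n%:R * `|p| * `|w|.
Proof.
rewrite dotE (le_trans (ler_norm_sum _ _ _)) //.
have -> : n%:R * `|p| * `|w| = \sum_(i < n) `|p| * `|w|.
  by rewrite sumr_const card_ord -mulrA mulr_natl.
by apply: ler_sum => i _; rewrite normrM ler_pM // coord_le_norm.
Qed.

End Dot.

Section OptimalFeedback.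
Context {R : realType} {nx nu : nat}.
Variable P : control_problem R nx nu.
Hypothesis A1 : posdef (control_weight P).
Hypothesis A2 : smooth_data P.
Implicit Types (z p : 'cV[R]_nx) (v : 'cV[R]_nu).
Local Notation W := (control_weight P).

Definition feedback z p : 'cV[R]_nu := - (invmx W *m (input_gain P z)^T *m p).
Definition closed_velocity z p : 'cV[R]_nx := velocity P z (feedback z p).
Definition min_hamiltonian z p : R := hamiltonian P z p (feedback z p).
(** The control is frozen at the feedback before the state is differentiated. As the feedback
    minimizes the Hamiltonian, this is also the state gradient of [min_hamiltonian]; the co-state
    equation reads q' = - [costate_rate]. *)
Definition costate_rate z p : 'cV[R]_nx :=
  grad (fun y => hamiltonian P y p (feedback z p)) z.

(** A row v of the left kernel satisfies v W = 0, hence v W v^T = 0, which positive definiteness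
    allows only for v = 0. *)
Lemma control_weight_unit : W \in unitmx.
Proof.
rewrite -row_free_unit -kermx_eq0; apply/eqP/row_matrixP => i; rewrite row0.
apply/eqP/contraT => ri.
have [_ /(_ (row i (kermx W))^T)] := A1.
rewrite trmxK -row_mul mulmx_ker row0 mul0mx mxE ltxx; apply.
by apply: contra ri => /eqP h; rewrite -[row i _]trmxK h trmx0.
Qed.

Lemma quad_ge0 v : 0 <= (v^T *m W *m v) 0 0.
Proof.
have [->|v0] := eqVneq v 0; first by rewrite mulmx0 mxE.
by have [_ /(_ v v0) /ltW] := A1.
Qed.

Lemma quad_eq0 v : (v^T *m W *m v) 0 0 = 0 -> v = 0.
Proof.
move=> v0; apply/eqP/contraT => vn0.
by have [_ /(_ v vn0)] := A1; rewrite v0 ltxx.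
Qed.

(* Completion of the square: g(z)^T p = - W (feedback z p). *)
Lemma hamiltonian_square z p v :
  hamiltonian P z p v = min_hamiltonian z p +
    2^-1 * ((v - feedback z p)^T *m W *m (v - feedback z p)) 0 0.
Proof.
set f := feedback z p; set g := input_gain P z.
have Wsym : W^T = W by case: A1.
have gp : p^T *m g = - (f^T *m W).
  rewrite /f /feedback linearN /= mulNmx opprK !trmx_mul trmxK trmx_inv Wsym.
  by rewrite -!mulmxA mulVmx ?mulmx1 //; exact: control_weight_unit.
have cross u : (p^T *m velocity P z u) 0 0 = (p^T *m drift P z) 0 0 - (f^T *m W *m u) 0 0.
  by rewrite /velocity mulmxDr mxE mulmxA -/g gp mulNmx [in X in _ + X]mxE.
have vf : (v^T *m W *m f) 0 0 = (f^T *m W *m v) 0 0.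
  by rewrite -[in LHS](trmxK (v^T *m W *m f)) [LHS]mxE !trmx_mul trmxK Wsym mulmxA.
rewrite /min_hamiltonian -/f /hamiltonian /running_cost !cross.
have -> : ((v - f)^T *m W *m (v - f)) 0 0 = (v^T *m W *m v) 0 0
    - (v^T *m W *m f) 0 0 - (f^T *m W *m v) 0 0 + (f^T *m W *m f) 0 0.
  have mB (A B : 'M[R]_1) : (A - B) 0 0 = A 0 0 - B 0 0 by rewrite !mxE.
  have -> : (v - f)^T = v^T - f^T by rewrite linearB.
  by rewrite !mulmxBl !mulmxBr !mB; ring.
by rewrite vf; field.
Qed.

Lemma min_hamiltonian_le z p v : min_hamiltonian z p <= hamiltonian P z p v.
Proof. by rewrite hamiltonian_square lerDl mulr_ge0 ?quad_ge0 ?invr_ge0. Qed.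

(** The feedback attains the minimum, so the abstract minimum in the HJB equation becomes a locally
    Lipschitz expression in the state and the gradient. *)
Lemma is_min_hamiltonian z p m :
  is_min (range (hamiltonian P z p)) m -> m = min_hamiltonian z p.
Proof.
move=> [[v _ <-] lb]; apply/le_anti/andP; split; last exact: min_hamiltonian_le.
by apply: lb; exists (feedback z p).
Qed.

(** The Hamiltonian is affine in the co-state, with the velocity as slope. *)
Lemma hamiltonian_shift z p p' v :
  hamiltonian P z p v = hamiltonian P z p' v + dot (p - p') (velocity P z v).
Proof. by rewrite /hamiltonian dotBl /dot; ring. Qed.

Let Cf : class_C 2 (drift P). Proof. by case: A2 => h *; apply: class_C_le h. Qed.
Let Cg : class_C 2 (input_gain P). Proof. by case: A2 => _ h *; apply: class_C_le h. Qed.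
Let Cl : class_C 2 (state_cost P). Proof. by case: A2 => _ _ h *; apply: class_C_le h. Qed.

Let bf : ball_lip (drift P). Proof. by apply: ball_lip_C1; apply: class_C_le Cf. Qed.
Let bg : ball_lip (input_gain P). Proof. by apply: ball_lip_C1; apply: class_C_le Cg. Qed.
Let bl : ball_lip (state_cost P). Proof. by apply: ball_lip_C1_scalar; apply: class_C_le Cl. Qed.

Lemma ball_lip_feedback : ball_lip (fun zp : 'cV[R]_nx * 'cV[R]_nx => feedback zp.1 zp.2).
Proof.
apply/ball_lipN/ball_lip_mulmx; last exact: ball_lip_snd.
apply: ball_lip_mulmx; first exact: ball_lip_cst.
by apply/ball_lip_tr/ball_lip_comp; [exact: bg|exact: ball_lip_fst].
Qed.

Lemma ball_lip_velocity : ball_lip (fun zv : 'cV[R]_nx * 'cV[R]_nu => velocity P zv.1 zv.2).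
Proof.
apply: ball_lipD; first by apply: ball_lip_comp bf _; exact: ball_lip_fst.
by apply: ball_lip_mulmx; [apply: ball_lip_comp bg _; exact: ball_lip_fst|exact: ball_lip_snd].
Qed.

Lemma ball_lip_running_cost : ball_lip (fun zv : 'cV[R]_nx * 'cV[R]_nu => running_cost P zv.1 zv.2).
Proof.
apply: ball_lipD; first by apply: ball_lip_comp bl _; exact: ball_lip_fst.
apply: ball_lipM; first exact: ball_lip_cst.
apply: ball_lip_coord; apply: ball_lip_mulmx; last exact: ball_lip_snd.
by apply: ball_lip_mulmx; [apply/ball_lip_tr; exact: ball_lip_snd|exact: ball_lip_cst].
Qed.

Lemma ball_lip_closed_velocity :
  ball_lip (fun zp : 'cV[R]_nx * 'cV[R]_nx => closed_velocity zp.1 zp.2).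
Proof.
apply: (ball_lip_comp (G := fun zp : _ * _ => (zp.1, feedback zp.1 zp.2)) ball_lip_velocity).
by apply: ball_lip_pair; [exact: ball_lip_fst|exact: ball_lip_feedback].
Qed.

Lemma ball_lip_min_hamiltonian :
  ball_lip (fun zp : 'cV[R]_nx * 'cV[R]_nx => min_hamiltonian zp.1 zp.2).
Proof.
apply: ball_lipD.
  apply: (ball_lip_comp (G := fun zp : _ * _ => (zp.1, feedback zp.1 zp.2)) ball_lip_running_cost).
  by apply: ball_lip_pair; [exact: ball_lip_fst|exact: ball_lip_feedback].
by apply/ball_lip_coord/ball_lip_mulmx; [apply/ball_lip_tr/ball_lip_snd|exact: ball_lip_closed_velocity].
Qed.

Lemma differentiable_hamiltonian z p v :
  differentiable (fun y => hamiltonian P y p v) z.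
Proof.
have [df _] := Cf; have [dg _] := Cg; have [dl _] := Cl.
rewrite (_ : (fun y => _) = fun y => state_cost P y + 2^-1 * (v^T *m W *m v) 0 0 +
    \sum_j p j 0 * (drift P y j 0 + \sum_k v k 0 * input_gain P y j k)); last first.
  apply/funext => y; rewrite /hamiltonian /running_cost -/(dot _ _) dotE.
  congr (_ + _); apply: eq_bigr => j _; rewrite !mxE; congr (_ * (_ + _)).
  by apply: eq_bigr => k _; rewrite mulrC.
apply: differentiableD; first by apply: differentiableD.
rewrite -fct_sumE; apply: differentiable_sum => j.
apply: differentiableM; first exact: differentiable_cst.
apply: differentiableD; first exact: differentiable_mx_coord.
rewrite -fct_sumE; apply: differentiable_sum => k; apply: differentiableM; first exact: differentiable_cst.
exact: differentiable_mx_coord.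
Qed.

Lemma derive_hamiltonian z p v i :
  'D_(delta_mx i 0) (fun y => hamiltonian P y p v) z =
  'D_(delta_mx i 0) (state_cost P) z +
  (p^T *m ('D_(delta_mx i 0) (drift P) z + 'D_(delta_mx i 0) (input_gain P) z *m v)) 0 0.
Proof.
have [df _] := Cf; have [dg _] := Cg; have [dl _] := Cl.
set e : 'cV[R]_nx := delta_mx i 0.
have Dc m n (F : 'cV[R]_nx -> 'M[R]_(m, n)) j k : (forall y, differentiable F y) ->
    is_derive z e (fun y => F y j k) ('D_e F z j k).
  move=> dF; apply: DeriveDef; first exact/diff_derivable/differentiable_mx_coord.
  by rewrite [in RHS]derive_mx ?mxE //; exact: diff_derivable.
rewrite (_ : (fun y => _) = fun y => state_cost P y + 2^-1 * (v^T *m W *m v) 0 0 +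
    \sum_j p j 0 * (drift P y j 0 + \sum_k v k 0 * input_gain P y j k)); last first.
  apply/funext => y; rewrite /hamiltonian /running_cost -/(dot _ _) dotE.
  congr (_ + _); apply: eq_bigr => j _; rewrite !mxE; congr (_ * (_ + _)).
  by apply: eq_bigr => k _; rewrite mulrC.
have hg j : is_derive z e (fun y => \sum_k v k 0 * input_gain P y j k)
    (\sum_k v k 0 * 'D_e (input_gain P) z j k).
  rewrite -fct_sumE; apply: is_derive_sum => k.
  exact: (is_deriveZ (v k 0) (Dc _ _ _ j k dg)).
have hf j : is_derive z e (fun y => p j 0 * (drift P y j 0 + \sum_k v k 0 * input_gain P y j k))
    (p j 0 * ('D_e (drift P) z j 0 + \sum_k v k 0 * 'D_e (input_gain P) z j k)).
  exact: (is_deriveZ (p j 0) (is_deriveD (Dc _ _ _ j 0 df) (hg j))).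
have hs : is_derive z e (fun y => \sum_j p j 0 * (drift P y j 0 + \sum_k v k 0 * input_gain P y j k))
    (\sum_j p j 0 * ('D_e (drift P) z j 0 + \sum_k v k 0 * 'D_e (input_gain P) z j k)).
  by rewrite -fct_sumE; exact: is_derive_sum.
have hl : is_derive z e (state_cost P) ('D_e (state_cost P) z).
  by apply: DeriveDef => //; exact: diff_derivable.
have := is_deriveD (is_deriveD hl (is_derive_cst (2^-1 * (v^T *m W *m v) 0 0) z e)) hs.
case=> _ ->; rewrite addr0 -/(dot _ _) dotE; congr (_ + _).
apply: eq_bigr => j _; rewrite !mxE; congr (_ * (_ + _)).
by apply: eq_bigr => k _; rewrite mulrC.
Qed.

(** First derivatives of the data are still of class C^1, hence Lipschitz on balls. This makes the
    co-state equation a Cauchy problem with locally Lipschitz right-hand side. *)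
Lemma ball_lip_derive_hamiltonian i : ball_lip
  (fun zpv : 'cV[R]_nx * ('cV[R]_nx * 'cV[R]_nu) =>
    'D_(delta_mx i 0) (fun y => hamiltonian P y zpv.2.1 zpv.2.2) zpv.1).
Proof.
apply: ball_lip_ext (fun zpv => esym (derive_hamiltonian _ _ _ _)) _.
apply: ball_lipD.
  apply: (ball_lip_comp (F := 'D_(delta_mx i 0) (state_cost P))); last exact: ball_lip_fst.
  by apply: ball_lip_C1_scalar; case: Cl => _; exact.
apply: ball_lip_coord; apply: ball_lip_mulmx.
  by apply: ball_lip_tr; apply: ball_lip_comp; [exact: ball_lip_fst|exact: ball_lip_snd].
apply: ball_lipD.
  apply: (ball_lip_comp (F := 'D_(delta_mx i 0) (drift P))); last exact: ball_lip_fst.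
  by apply: ball_lip_C1; case: Cf => _; exact.
apply: ball_lip_mulmx.
  apply: (ball_lip_comp (F := 'D_(delta_mx i 0) (input_gain P))); last exact: ball_lip_fst.
  by apply: ball_lip_C1; case: Cg => _; exact.
by apply: ball_lip_comp; [exact: ball_lip_snd|exact: ball_lip_snd].
Qed.

Lemma costate_rateE z p i : costate_rate z p i 0 =
  'D_(delta_mx i 0) (fun y => hamiltonian P y p (feedback z p)) z.
Proof. by rewrite mxE. Qed.

Lemma ball_lip_costate_rate :
  ball_lip (fun zp : 'cV[R]_nx * 'cV[R]_nx => costate_rate zp.1 zp.2).
Proof.
apply: ball_lip_mx => i j; rewrite (ord1 j).
apply: ball_lip_ext (fun zp => esym (costate_rateE _ _ _)) _.
apply: (ball_lip_comp (G := fun zp : _ * _ => (zp.1, (zp.2, feedback zp.1 zp.2)))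
  (ball_lip_derive_hamiltonian i)).
apply: ball_lip_pair; first exact: ball_lip_fst.
by apply: ball_lip_pair; [exact: ball_lip_snd|exact: ball_lip_feedback].
Qed.

End OptimalFeedback.

(** * Grids and integrals on an interval *)
Section Discretization.
Context {R : realType}.

(** Chooses a tolerance [d] whose amplification by [K] fits the budget [e]; the denominator [K + 1]
    covers [K = 0]. *)
Lemma small_factor (K e : R) : 0 <= K -> 0 < e -> exists2 d : R, 0 < d & K * d <= e.
Proof.
move=> K0 e0; exists (e / (K + 1)); first by rewrite divr_gt0 // ltr_wpDl.
by rewrite mulrA ler_pdivrMr ?ltr_wpDl // mulrC ler_pM2l // lerDl.
Qed.

Lemma norm_small_eq0 n (v : 'cV[R]_n) : (forall e : R, 0 < e -> `|v| <= e) -> v = 0.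
Proof.
move=> h; apply/eqP; rewrite -normr_eq0; apply/eqP/le_anti/andP; split => //.
by apply/ler_addgt0Pr => e e0; rewrite add0r; exact: h.
Qed.

(** The length [a] may be negative, because some grids run backwards in time. *)
Lemma fine_partition (a d : R) : 0 < d ->
  exists2 N : nat, (0 < N)%N & `|a / N%:R| <= d.
Proof.
move=> d0; exists (Num.bound (`|a| / d)).+1 => //.
rewrite normrM normfV normr_nat ler_pdivrMr ?ltr0n // mulrC -ler_pdivrMr //.
have ad : 0 <= `|a| / d by rewrite divr_ge0 // ltW.
apply/ltW/(lt_trans (archi_boundP ad)); rewrite ltr_nat; exact: ltnSn.
Qed.

(** Passes from short time spans to all of [0, T]: the length [dl] of a step is uniform, so finitely
    many steps reach any [t]. *)
Lemma interval_chain (T : R) (Q : R -> Prop) (dl : R) : 0 < dl -> Q 0 ->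
  (forall t s : R, t \in `[0, T] -> s \in `[0, T] -> t < s -> s - t <= dl -> Q t -> Q s) ->
  forall t : R, t \in `[0, T] -> Q t.
Proof.
move=> dl0 Q0 step.
have H n : forall t : R, t \in `[0, T] -> t <= n%:R * dl -> Q t.
  elim: n => [|n IH] t; rewrite in_itv /= => /andP[t0 tT].
    by rewrite mul0r => t0'; have -> : t = 0 by apply/le_anti/andP.
  move=> tn; have [->//|tn0] := eqVneq t 0.
  have t0' : 0 < t by rewrite lt0r tn0.
  (* The predecessor of [t] is [t - dl], cut off at 0. *)
  have sn : Num.max 0 (t - dl) <= n%:R * dl.
    rewrite ge_max mulr_ge0 ?(ltW dl0) //=; move: tn; rewrite -addn1 natrD; lra.
  have st : Num.max 0 (t - dl) < t by rewrite gt_max t0' /=; lra.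
  apply: (step (Num.max 0 (t - dl))) => //; rewrite ?in_itv /=.
  - by rewrite le_max lexx /= (le_trans (ltW st)).
  - by rewrite (ltW t0').
  - have : t - dl <= Num.max 0 (t - dl) by rewrite le_max lexx orbT.
    lra.
  - apply: IH => //; rewrite in_itv /= le_max lexx /=; exact: le_trans (ltW st) tT.
move=> t tT; apply: (H (Num.bound (t / dl))) => //.
rewrite -ler_pdivrMr //; apply: le_trans (ler_norm _) _.
have td0 : 0 <= t / dl by rewrite divr_ge0 ?(ltW dl0) //; move: tT; rewrite in_itv => /andP[].
by rewrite ger0_norm // ltW // archi_boundP.
Qed.

Lemma telescope_le n (y b : nat -> 'cV[R]_n) (c a : R) N :
  (forall k, (k < N)%N -> `|y k.+1 - y k - c *: b k| <= a) ->
  forall k, (k <= N)%N -> `|y k - y 0%N - c *: \sum_(j < k) b j| <= k%:R * a.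
Proof.
move=> h; elim => [|k IH] kN; first by rewrite big_ord0 scaler0 subr0 subrr normr0 mul0r.
rewrite big_ord_recr /= scalerDr -natr1 mulrDl mul1r.
rewrite (_ : _ - _ = (y k - y 0%N - c *: \sum_(j < k) b j) + (y k.+1 - y k - c *: b k)).
  by apply: le_trans (ler_normD _ _) _; apply: lerD; [apply/IH/ltnW|exact: h].
by apply/matrixP => i j; rewrite !mxE; ring.
Qed.

(** Differentiability of [x] with derivative [w], uniform on [0, T] and one-sided at the end points.
    Trajectories given by pointwise derivatives and by integrals both reduce to it, and it is
    directly comparable with polygons; [t'] may precede [t]. *)
Definition unif_diff (T : R) n (x w : R -> 'cV[R]_n) := forall e : R, 0 < e ->
  exists2 d : R, 0 < d & forall t t', t \in `[0, T] -> t' \in `[0, T] ->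
    `|t' - t| <= d -> `|x t' - x t - (t' - t) *: w t| <= `|t' - t| * e.

(** The trajectory is compared with its left Riemann sums. Each of the [N] steps costs |c| e1, and N
    |c| is at most [T], so the errors add up to at most [T * e1]; the step [c] may be negative. *)
Lemma unif_diff_sum T n (x w : R -> 'cV[R]_n) e : 0 < T -> unif_diff T x w -> 0 < e ->
  exists2 d : R, 0 < d & forall (t0 c : R) N, `|c| <= d -> N%:R * `|c| <= T ->
    (forall k, (k <= N)%N -> t0 + k%:R * c \in `[0, T]) -> forall k, (k <= N)%N ->
    `|x (t0 + k%:R * c) - x t0 - c *: \sum_(j < k) w (t0 + j%:R * c)| <= e.
Proof.
move=> T0 ud e0; have [e1 e10 he1] := small_factor (ltW T0) e0.
have [d d0 h] := ud _ e10; exists d => // t0 c N cd NT tT k kN.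
have := @telescope_le _ (fun k => x (t0 + k%:R * c)) (fun k => w (t0 + k%:R * c)) c (`|c| * e1) N.
rewrite mul0r addr0 => /(_ _ k kN) /le_trans; apply.
  move=> m mN; have := h _ _ (tT m (ltnW mN)) (tT m.+1 mN).
  have -> : t0 + m.+1%:R * c - (t0 + m%:R * c) = c by rewrite -natr1; ring.
  by apply.
apply: le_trans he1; rewrite mulrA; apply: ler_wpM2r; first exact: ltW.
by apply: le_trans NT; rewrite ler_wpM2r // ler_nat.
Qed.

Lemma ler_sum_const n (F : nat -> 'cV[R]_n) (k : nat) (b : R) :
  (forall j, (j < k)%N -> `|F j| <= b) -> `|\sum_(j < k) F j| <= k%:R * b.
Proof.
move=> Fb; apply: le_trans (ler_norm_sum _ _ _) _.
rewrite mulr_natl -[k in leRHS](card_ord k) -sumr_const; apply: ler_sum => j _.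
exact: Fb.
Qed.

Lemma itv_grid (T t0 t1 c : R) (N k : nat) : t0 \in `[0, T] -> t1 \in `[0, T] ->
  N%:R * c = t1 - t0 -> (k <= N)%N -> t0 + k%:R * c \in `[0, T].
Proof.
rewrite !in_itv /= => t0T t1T Nc kN.
have k0 : 0 <= k%:R :> R by [].
have kN' : k%:R <= N%:R :> R by rewrite ler_nat.
have [c0|/ltW c0] := leP 0 c; apply/andP; split; nra.
Qed.

(** Compares two sequences with the same start [x0]: two defects with respect to the sums [a] and
    [b], plus the difference of these sums. *)
Lemma subr_decompose (V : zmodType) (y x x0 a b : V) :
  y - x = (y - x0 - a) - (x - x0 - b) + (a - b).
Proof.
by rewrite addrAC subrKA -[x - x0 - b]addrA -[y - x0 - b]addrA -opprD opprB subrKA.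
Qed.

End Discretization.

(** * Integrals over subintervals of [0, T] *)

Section IntervalIntegral.
Context {R : realType}.
Variable T : R.
Local Notation mu := (@lebesgue_measure R).
Local Notation D := (`[0, T]%classic : set R).
Implicit Types (f g h : R -> R) .

Definition integrable_on (A : set (measurableTypeR R)) f := mu.-integrable A (EFin \o f).

Lemma integrable_on_continuous h : {within D, continuous h} -> integrable_on D h.
Proof. by move=> ch; apply: continuous_compact_integrable => //; exact: segment_compact. Qed.

Lemma integrable_onD A f g : measurable A -> integrable_on A f -> integrable_on A g ->
  integrable_on A (fun s => f s + g s).
Proof. by move=> mA fi gi; exact: (integrableD mA fi gi). Qed.

Lemma integrable_onZ A f (c : R) : measurable A -> integrable_on A f ->
  integrable_on A (fun s => c * f s).
Proof. by move=> mA fi; exact: (integrableZl mA c fi). Qed.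

Lemma integrable_onB A f g : measurable A -> integrable_on A f -> integrable_on A g ->
  integrable_on A (fun s => f s - g s).
Proof. by move=> mA fi gi; exact: (integrableB mA fi gi). Qed.

Lemma integrable_on_norm A f : measurable A -> integrable_on A f ->
  integrable_on A (fun s => `|f s|).
Proof. by move=> mA fi; exact: (integrable_norm fi). Qed.

Lemma integrable_on_cst A (c : R) : measurable A -> (mu A < +oo)%E ->
  integrable_on A (fun _ => c).
Proof.
move=> mA fA; apply: measurable_bounded_integrable => //.
exists `|c|; split; first exact: num_real.
by move=> b /ltW cb s _.
Qed.

Lemma integrable_on_measurable A f : integrable_on A f -> @measurable_fun _ _ (measurableTypeR R) R A f.
Proof. by move=> /measurable_int /measurable_realfun.measurable_EFinP. Qed.

Lemma integrable_on_sub A B f : measurable A -> measurable B -> A `<=` B ->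
  integrable_on B f -> integrable_on A f.
Proof. by move=> mA mB AB fi; exact: (integrableS mB mA AB fi). Qed.

Lemma integrable_on_contM h f : {within D, continuous h} -> integrable_on D f ->
  integrable_on D (fun s => h s * f s).
Proof.
move=> ch fi; have mh := integrable_on_measurable (integrable_on_continuous ch).
apply: (integrableMr _ mh _ fi) => //.
have [B B0 hB] := compact_bound (@segment_compact _ 0 T) ch.
exists B; split; first exact: num_real.
by move=> b Bb s /= sD; apply: le_trans (hB _ sD) (ltW Bb).
Qed.

Lemma integrable_on_le A f g : measurable A -> @measurable_fun _ _ (measurableTypeR R) R A f -> integrable_on A g ->
  (forall s, A s -> `|f s| <= g s) -> integrable_on A f.
Proof.
move=> mA mf gi fg; apply: (le_integrable mA _ _ gi); first exact/measurable_realfun.measurable_EFinP.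
move=> s As /=; rewrite lee_fin; apply: le_trans (fg s As) _; exact: ler_norm.
Qed.

Lemma integrable_on_sum A (I : finType) (F : I -> R -> R) : measurable A ->
  (forall i, integrable_on A (F i)) ->
  integrable_on A (fun s => \sum_i F i s) /\
  \int[mu]_(s in A) (\sum_i F i s) = \sum_i \int[mu]_(s in A) F i s.
Proof.
move=> mA hF; elim: (index_enum I) => [|i l [IH1 IH2]].
  split; first by under [X in integrable_on _ X]eq_fun do rewrite big_nil; exact: integrable0.
  rewrite big_nil; under eq_Rintegral do rewrite big_nil.
  by rewrite Rintegral_cst // mul0r.
have E s : \sum_(j <- i :: l) F j s = F i s + \sum_(j <- l) F j s by rewrite big_cons.
split.
  rewrite (_ : (fun s => _) = fun s => F i s + \sum_(j <- l) F j s); last exact/funext.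
  exact: integrable_onD.
under eq_Rintegral do rewrite E.
by rewrite (RintegralD mA (hF i) IH1) big_cons IH2.
Qed.

Lemma integrable_on_sub_itv f (a b : R) : 0 <= a -> b <= T -> integrable_on D f ->
  integrable_on `]a, b] f.
Proof.
move=> a0 bT; apply: integrable_on_sub => // s /=.
rewrite !in_itv /= => /andP[as_ sb]; apply/andP; split.
  exact: le_trans a0 (ltW as_).
exact: le_trans sb bT.
Qed.

Lemma Rintegral_increment f (a b : R) : 0 <= a -> a <= b -> b <= T -> integrable_on D f ->
  \int[mu]_(s in `[0, b]) f s - \int[mu]_(s in `[0, a]) f s = \int[mu]_(s in `]a, b]) f s.
Proof.
move=> a0 ab bT fi; apply: Rintegral_itvB.
- apply: integrable_on_sub fi => // s /=; rewrite !in_itv /= => /andP[-> sb] /=.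
  exact: le_trans sb bT.
- by rewrite bnd_simp.
- by rewrite bnd_simp.
Qed.

Lemma Rintegral_itv_cst (a b c : R) : a <= b -> \int[mu]_(s in `]a, b]) c = (b - a) * c.
Proof.
move=> ab; have E : mu `]a, b] = (b - a)%:E.
  rewrite lebesgue_measure_itv /= lte_fin.
  by move: ab; rewrite le_eqVlt => /predU1P[->|->] //; rewrite ltxx subrr.
by rewrite Rintegral_cst // mulrC; congr (_ * _); exact: (congr1 fine E).
Qed.

Lemma itv_oc_finite (a b : R) : (mu `]a, b] < +oo)%E.
Proof.
by rewrite lebesgue_measure_itv /=; case: ifP => // _; rewrite -EFinB ltry.
Qed.

(** A fundamental theorem of calculus without pointwise derivatives: the defects on the cells of a
    fine grid add up to at most [e] times the integral of [g]. Weighing by an integrable [g] instead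
    of by length admits velocities that are merely integrable. *)
Lemma Rintegral_partition (F w g : R -> R) : 0 < T ->
  integrable_on D w -> integrable_on D g ->
  (forall e : R, 0 < e -> exists2 d : R, 0 < d & forall a b, 0 <= a -> a < b -> b <= T ->
    b - a <= d -> `|F b - F a - \int[mu]_(s in `]a, b]) w s| <= e * \int[mu]_(s in `]a, b]) g s) ->
  F T - F 0 = \int[mu]_(s in D) w s.
Proof.
move=> T0 wi gi step.
pose W t := \int[mu]_(s in `[0, t]) w s; pose G t := \int[mu]_(s in `[0, t]) g s.
have at0 f : \int[mu]_(s in `[0, 0]) f s = 0 by rewrite set_itv1 Rintegral_set1.
apply/eqP; rewrite -subr_eq0 -normr_eq0; apply/eqP/le_anti/andP; split => //.
apply/ler_addgt0Pr => e e0; rewrite add0r.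
have [e1 e10 he1] := small_factor (normr_ge0 (G T)) e0.
have [d d0 h] := step e1 e10.
have [N N0 Nd] := fine_partition T d0.
pose c := T / N%:R.
have c0 : 0 < c by rewrite divr_gt0 // ltr0n.
have NcE : N%:R * c = T by rewrite /c mulrC divfK // pnatr_eq0 -lt0n.
have S k : (k <= N)%N -> `|F (k%:R * c) - F 0 - W (k%:R * c)| <= e1 * G (k%:R * c).
  elim: k => [|k IH] kN; first by rewrite mul0r /W /G !at0 subrr subr0 normr0 mulr0.
  have ck : k.+1%:R * c = k%:R * c + c by rewrite -natr1 mulrDl mul1r.
  have a0 : 0 <= k%:R * c by rewrite mulr_ge0 // ltW.
  have ab : k%:R * c < k.+1%:R * c by rewrite ck ltrDl.
  have bT : k.+1%:R * c <= T by rewrite -[leRHS]NcE ler_wpM2r ?ler_nat // ltW.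
  have := h _ _ a0 ab bT; rewrite {1}ck addrAC subrr add0r => /(_ (le_trans (ler_norm c) Nd)).
  rewrite -!(Rintegral_increment a0 (ltW ab) bT) // -/(W _) -/(W (k%:R * c)) -/(G _) -/(G (k%:R * c)).
  move=> H; have {}IH := IH (ltnW kN).
  rewrite (_ : _ - _ = (F (k%:R * c) - F 0 - W (k%:R * c)) +
     (F (k.+1%:R * c) - F (k%:R * c) - (W (k.+1%:R * c) - W (k%:R * c)))); last by ring.
  apply: le_trans (ler_normD _ _) _; apply: le_trans (lerD IH H) _.
  by rewrite mulrBr addrC subrK.
have := S N (leqnn N); rewrite NcE => /le_trans; apply.
apply: le_trans he1; rewrite mulrC; apply: ler_wpM2r; first exact: ltW.
exact: ler_norm.
Qed.

End IntervalIntegral.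

(** * Differential equations, integral equations and uniform differentiability *)

Section IntegralEquation.
Context {R : realType}.
Local Notation mu := (@lebesgue_measure R).
Implicit Types U V W : normedModType R.

Lemma normr_le_sqrD1 (a : R) : `|a| <= 1 + a ^+ 2.
Proof.
rewrite -[a ^+ 2]real_normK ?num_real // expr2.
have := sqr_ge0 (`|a| - 2^-1); rewrite expr2; nra.
Qed.

Lemma normrM_le_sqrD (a b : R) : `|a * b| <= a ^+ 2 + b ^+ 2.
Proof. by rewrite ler_norml !expr2; apply/andP; split; nra. Qed.

Lemma ae_imply (Q1 Q2 : R -> Prop) : (forall s, Q1 s -> Q2 s) ->
  {ae @lebesgue_measure R, forall s, Q1 s} -> {ae @lebesgue_measure R, forall s, Q2 s}.
Proof.
move=> Q12 [N [mN N0 sN]]; exists N; split => // s nQ2.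
by apply: sN => Q1s; exact/nQ2/Q12.
Qed.

(** Near [z] the values of [g] stay in the ball of radius |g z| + 1, where one Lipschitz constant of
    [F] serves. *)
Lemma within_ball_lip U V W (A : set U) (F : V -> W) (g : U -> V) :
  ball_lip F -> {within A, continuous g} -> {within A, continuous (fun x => F (g x))}.
Proof.
move=> hF /within_continuousP cg; apply/within_continuousP => z Az e e0.
have [L L0 FL] := hF (`|g z| + 1).
have e20 : 0 < e / 2 by rewrite divr_gt0.
have [d d0 hd] := small_factor L0 e20.
have d10 : 0 < Num.min 1 d by rewrite lt_min ltr01.
have [c c0 hc] := cg z Az _ d10; exists c => // w Aw zw.
have := hc w Aw zw; rewrite lt_min => /andP[g1 gd].
have zM : `|g z| <= `|g z| + 1 by rewrite lerDl.
have wM : `|g w| <= `|g z| + 1.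
  rewrite -(subrK (g z) (g w)) addrC; apply: le_trans (ler_normD _ _) _.
  by rewrite lerD2l distrC ltW.
apply: le_lt_trans (FL _ _ zM wM) _; apply: le_lt_trans (ler_wpM2l L0 (ltW gd)) _.
by apply: le_lt_trans hd _; rewrite ltr_pdivrMr // ltr_pMr // ltr1n.
Qed.

Lemma within_pair U V W (A : set U) (f : U -> V) (g : U -> W) :
  {within A, continuous f} -> {within A, continuous g} ->
  {within A, continuous (fun x => (f x, g x))}.
Proof.
move=> /within_continuousP cf /within_continuousP cg; apply/within_continuousP => z Az e e0.
have [c c0 hc] := cf z Az e e0; have [d d0 hd] := cg z Az e e0.
exists (Num.min c d); first by rewrite lt_min c0.
move=> w Aw; rewrite lt_min => /andP[zc zd].
by rewrite prod_normE /= gt_max hc // hd.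
Qed.

Lemma within_coord U m n (A : set U) (f : U -> 'M[R]_(m, n)) i j :
  {within A, continuous f} -> {within A, continuous (fun x => f x i j)}.
Proof.
have bc : ball_lip (fun B : 'M[R]_(m, n) => B i j).
  by apply: ball_lip_coord => M; exists 1 => // z w _ _; rewrite mul1r.
exact: within_ball_lip bc.
Qed.

(** The mean value theorem is applied to each coordinate, with its own intermediate point, and
    combined with the uniform continuity of [w]. The maximum norm lets the coordinates be treated
    separately. *)
Lemma unif_diff_of_derive T n (x w : R -> 'cV[R]_n) :
  {within `[0, T], continuous x} -> {within `[0, T], continuous w} ->
  (forall t : R, t \in `]0, T[ -> is_derive t 1 x (w t)) -> unif_diff T x w.
Proof.
move=> cx cw dx e e0.
have [d d0 h] := compact_unif_cont (@segment_compact _ 0 T) cw e0.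
have mvt a b i : a \in `[0, T] -> b \in `[0, T] -> a < b ->
    exists2 s : R, a < s < b & x b i 0 - x a i 0 = w s i 0 * (b - a).
  rewrite !in_itv /= => /andP[a0 aT] /andP[b0 bT] ab.
  have dxi (s : R) : s \in `]a, b[ -> is_derive s 1 (fun s => x s i 0) (w s i 0).
    rewrite in_itv /= => /andP[as_ sb].
    have [|dv dE] := dx s; first by rewrite in_itv /= (le_lt_trans a0 as_) (lt_le_trans sb bT).
    apply: DeriveDef; first exact: (derivable_mxP _ _ _).1 dv _ _.
    by rewrite -dE derive_mx // mxE.
  have [|s] := MVT ab dxi; last by rewrite in_itv /=; exists s.
  apply: (continuous_subspaceW _ (within_coord (i := i) (j := 0) cx)) => s /=.
  by rewrite !in_itv /= => /andP[as_ sb]; rewrite (le_trans a0 as_) (le_trans sb bT).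
have sT a b s : a \in `[0, T] -> b \in `[0, T] -> a < s < b -> s \in `[0, T].
  rewrite !in_itv /= => /andP[a0 _] /andP[_ bT] /andP[as_ sb].
  by rewrite (le_trans a0 (ltW as_)) (le_trans (ltW sb) bT).
exists d => // t t' tT t'T tt'd; apply: norm_le_coord; first by rewrite mulr_ge0 // ltW.
move=> i j; rewrite (ord1 j) {j} !mxE.
have key s : s \in `[0, T] -> `|s - t| <= d -> x t' i 0 - x t i 0 = w s i 0 * (t' - t) ->
    `|x t' i 0 - x t i 0 - (t' - t) * w t i 0| <= `|t' - t| * e.
  move=> sI sd ->; rewrite mulrC -mulrBr normrM; apply: ler_wpM2l => //.
  by have := coord_le_norm (w s - w t) i 0; rewrite !mxE => /le_trans; apply; exact: h.
case: (ltgtP t t') => [lt|gt|->].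
- have [s stt' E] := mvt t t' i tT t'T lt.
  apply: (key s) => //; first exact: sT stt'.
  apply: le_trans tt'd; case/andP: stt' => ts st'.
  by rewrite !gtr0_norm ?subr_gt0 // lerD2r ltW.
- have [s stt' E] := mvt t' t i t'T tT gt.
  apply: (key s); [exact: sT stt'| |by rewrite -opprB E -mulrN opprB].
  apply: le_trans tt'd; case/andP: stt' => ts st'.
  by rewrite !ltr0_norm ?subr_lt0 // lerN2 lerD2r ltW.
- by rewrite !subrr mul0r subrr normr0 mul0r.
Qed.

Lemma norm_Rintegral_le (A : set (measurableTypeR R)) (f g : R -> R) : measurable A ->
  integrable_on A f -> integrable_on A g -> (forall s, A s -> `|f s| <= g s) ->
  `|\int[mu]_(s in A) f s| <= \int[mu]_(s in A) g s.
Proof.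
move=> mA fi gi fg; apply: le_trans (le_normr_Rintegral mA fi) _.
apply: le_Rintegral => //; exact: integrable_on_norm.
Qed.

Lemma Rintegral_near_cst T (f : R -> R) (e : R) : {within `[0, T], continuous f} -> 0 < e ->
  exists2 d : R, 0 < d & forall a b c, 0 <= a -> b <= T -> a <= c <= b -> b - a <= d ->
    `|\int[mu]_(s in `]a, b]) f s - (b - a) * f c| <= (b - a) * e.
Proof.
move=> cf e0; have [d d0 h] := compact_unif_cont (@segment_compact _ 0 T) cf e0.
exists d => // a b c a0 bT /andP[ac cb] abd; have ab := le_trans ac cb.
have fi : integrable_on `]a, b] f.
  exact: integrable_on_sub_itv a0 bT (integrable_on_continuous cf).
have ci k : integrable_on `]a, b] (fun=> k) by apply: integrable_on_cst => //; exact: itv_oc_finite.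
rewrite -(Rintegral_itv_cst (f c) ab) -(Rintegral_itv_cst e ab) -(RintegralB _ fi (ci _)) //.
apply: norm_Rintegral_le => //; first exact: integrable_onB.
move=> s /=; rewrite in_itv /= => /andP[as_ sb].
apply: h => /=; rewrite ?in_itv /=.
- by rewrite (le_trans a0 (ltW as_)) (le_trans sb bT).
- by rewrite (le_trans a0 ac) (le_trans cb bT).
- by rewrite ler_norml; apply/andP; split; move: abd as_ sb ac cb; clear; lra.
Qed.

Lemma unif_diff_of_integral T n (x w : R -> 'cV[R]_n) : {within `[0, T], continuous w} ->
  (forall (t : R) i, t \in `[0, T] -> x t i 0 = x 0 i 0 + \int[mu]_(s in `[0, t]) w s i 0) ->
  unif_diff T x w.
Proof.
move=> cw xE e e0.
have /choice [d hd] : forall i : 'I_n, exists d : R, 0 < d /\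
    forall a b c, 0 <= a -> b <= T -> a <= c <= b -> b - a <= d ->
    `|\int[mu]_(s in `]a, b]) w s i 0 - (b - a) * w c i 0| <= (b - a) * e.
  by move=> i; have [d d0 h] := Rintegral_near_cst (within_coord (i := i) (j := 0) cw) e0; exists d.
(* The start value 1 keeps the minimum positive when [n = 0]. *)
exists (\big[Num.min/1]_i d i).
  by elim/big_ind: _ => // [a b a0 b0|i _]; [rewrite lt_min a0|case: (hd i)].
move=> t t' tT t'T tt'd; apply: norm_le_coord; first by rewrite mulr_ge0 // ltW.
move=> i j; rewrite (ord1 j) {j} !mxE.
have {}tt'd : `|t' - t| <= d i by apply: le_trans tt'd _; apply: bigmin_le_cond.
have incr a b : a \in `[0, T] -> b \in `[0, T] -> a <= b ->
    x b i 0 - x a i 0 = \int[mu]_(s in `]a, b]) w s i 0.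
  move=> aT bT ab; rewrite (xE b) // (xE a) // opprD addrACA subrr add0r.
  move: aT bT; rewrite !in_itv /= => /andP[a0 _] /andP[_ bT].
  apply: (Rintegral_increment a0 ab bT); apply: integrable_on_continuous.
  exact: within_coord.
have [_ h] := hd i.
have [tt'|/ltW tt'] := leP t t'.
  rewrite incr // (ger0_norm (_ : 0 <= t' - t)) ?subr_ge0 //.
  rewrite ger0_norm ?subr_ge0 // in tt'd.
  by move: tT t'T; rewrite !in_itv /= => /andP[t0 _] /andP[_ t'T]; apply: h; rewrite ?lexx.
rewrite distrC in tt'd; rewrite [X in _ <= X * _]distrC.
rewrite (_ : _ - _ = - (x t i 0 - x t' i 0 - (t - t') * w t i 0)); last by ring.
rewrite normrN incr // (ger0_norm (_ : 0 <= t - t')) ?subr_ge0 //.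
rewrite ger0_norm ?subr_ge0 // in tt'd.
by move: tT t'T; rewrite !in_itv /= => /andP[_ tT] /andP[t'0 _]; apply: h; rewrite ?lexx ?tt'.
Qed.

(** The partition argument with the weight [g = 1]: on a short cell, both the increment of [x] and
    the integral of [w] are close to the length times the value of [w] at the left end. *)
Lemma integral_of_unif_diff T n (x w : R -> 'cV[R]_n) : {within `[0, T], continuous w} ->
  unif_diff T x w -> forall (t : R) i, t \in `[0, T] ->
  x t i 0 = x 0 i 0 + \int[mu]_(s in `[0, t]) w s i 0.
Proof.
move=> cw ud t i; rewrite in_itv /= => /andP[t0 tT].
have sub : `[0, t] `<=` (`[0, T] : set R).
  by move=> s /=; rewrite !in_itv /= => /andP[-> st] /=; exact: le_trans st tT.
have cwt := continuous_subspaceW sub (within_coord (i := i) (j := 0) cw).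
move: t0; rewrite le_eqVlt => /predU1P[<-|t0].
  by rewrite set_itv1 Rintegral_set1 addr0.
rewrite -(@Rintegral_partition _ t (fun s => x s i 0) (fun s => w s i 0) (fun=> 1)) //.
- by rewrite subrKC.
- exact: integrable_on_continuous.
- by apply: integrable_on_continuous; apply: continuous_subspaceT; exact: cst_continuous.
move=> e e0; have e20 : 0 < e / 2 by rewrite divr_gt0.
have [d1 d10 h1] := ud _ e20; have [d2 d20 h2] := Rintegral_near_cst cwt e20.
exists (Num.min d1 d2); first by rewrite lt_min d10.
move=> a b a0 ab bt; rewrite le_min => /andP[ab1 ab2].
have ba : 0 <= b - a by rewrite subr_ge0 ltW.
rewrite Rintegral_itv_cst ?(ltW ab) // mulr1.
have aT : a \in `[0, T] by rewrite in_itv /= a0 (le_trans (ltW ab) (le_trans bt tT)).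
have bT : b \in `[0, T] by rewrite in_itv /= (le_trans a0 (ltW ab)) (le_trans bt tT).
have := h1 a b aT bT; rewrite (ger0_norm ba) => /(_ ab1) H1.
have {}H1 : `|x b i 0 - x a i 0 - (b - a) * w a i 0| <= (b - a) * (e / 2).
  by apply: le_trans H1; have := coord_le_norm (x b - x a - (b - a) *: w a) i 0; rewrite !mxE.
have := h2 a b a a0 bt; rewrite lexx (ltW ab) => /(_ isT ab2) H2.
rewrite (_ : _ - _ = (x b i 0 - x a i 0 - (b - a) * w a i 0) -
   (\int[mu]_(s in `]a, b]) w s i 0 - (b - a) * w a i 0)); last by ring.
apply: le_trans (ler_normB _ _) _; apply: le_trans (lerD H1 H2) _.
by rewrite -mulrDr -splitr mulrC.
Qed.

End IntegralEquation.

(** * Solutions of the HJB equation *)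
Section PartialDerivatives.
Context {R : realType}.
Implicit Types V : normedModType R.

Lemma derive_uncurry_fst V (phi : R -> V -> R) (t : R) (x : V) :
  'D_(1, 0) (fun z : R * V => phi z.1 z.2) (t, x) = 'D_1 (phi ^~ x) t.
Proof.
rewrite /derive [X in lim (X @ _)](_ : _ =
  (fun h : R => h^-1 *: ((phi ^~ x \o shift t) (h *: 1) - phi t x))) //.
by apply/funext => h /=; rewrite scaler0 add0r.
Qed.

Lemma derive_uncurry_snd V (phi : R -> V -> R) (t : R) (x v : V) :
  'D_(0, v) (fun z : R * V => phi z.1 z.2) (t, x) = 'D_v (phi t) x.
Proof.
rewrite /derive [X in lim (X @ _)](_ : _ =
  (fun h : R => h^-1 *: ((phi t \o shift x) (h *: v) - phi t x))) //.
by apply/funext => h /=; rewrite scaler0 add0r.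
Qed.

Lemma derive_uncurry V (phi : R -> V -> R) (t a : R) (x v : V) :
  differentiable (fun z : R * V => phi z.1 z.2) (t, x) ->
  'D_(a, v) (fun z : R * V => phi z.1 z.2) (t, x) =
  a * 'D_1 (phi ^~ x) t + 'D_v (phi t) x.
Proof.
move=> dphi; rewrite -derive_uncurry_fst -derive_uncurry_snd !deriveE //.
have -> : (a, v) = a *: (1, 0) + (0, v) :> R * V.
  by congr pair; rewrite /= ?scaler0 ?add0r // addr0 [LHS](esym (mulr1 a)).
by rewrite linearD linearZ.
Qed.

Lemma differentiable_snd V (phi : R -> V -> R) (t : R) (x : V) :
  differentiable (fun z : R * V => phi z.1 z.2) (t, x) -> differentiable (phi t) x.
Proof.
move=> dphi; have h := differentiable_comp (f := fun y : V => (t, y)) _ dphi.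
by apply: h; apply: differentiable_pair; [exact: differentiable_cst|by case: (is_diff_id x)].
Qed.

Lemma derive_grad n (F : 'cV[R]_n -> R) (x v : 'cV[R]_n) : differentiable F x ->
  'D_v F x = dot (grad F x) v.
Proof.
by move=> dF; rewrite derive_cV // dotE; apply: eq_bigr => i _; rewrite mxE mulrC.
Qed.

End PartialDerivatives.

Section ValueFunction.
Context {R : realType} {nx nu : nat}.
Variable P : control_problem R nx nu.
Hypothesis T_gt0 : 0 < horizon P.
Hypothesis A1 : posdef (control_weight P).
Hypothesis A2 : smooth_data P.
Variable phi : R -> 'cV[R]_nx -> R.
(* The continuous extension of grad phi to t = 0 and t = T. *)
Variable gphi : R -> 'cV[R]_nx -> 'cV[R]_nx.
Local Notation T := (horizon P).
Local Notation slab := (`[0, T] `*` [set: 'cV[R]_nx]).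
Hypothesis cphi : {within slab, continuous (fun tz : R * 'cV[R]_nx => phi tz.1 tz.2)}.
Hypothesis dphi : forall (t : R) x, t \in `]0, T[ ->
  differentiable (fun z : R * 'cV[R]_nx => phi z.1 z.2) (t, x).
Hypothesis cgphi : {within slab, continuous (fun tz : R * 'cV[R]_nx => gphi tz.1 tz.2)}.
Hypothesis gphiE : forall (t : R) x, t \in `]0, T[ -> grad (phi t) x = gphi t x.
Hypothesis HJB : forall (t : R) x, t \in `]0, T[ ->
  'D_1 (phi ^~ x) t = - min_hamiltonian P x (gphi t x).
Implicit Types (t M e : R) (z : 'cV[R]_nx).

(** * Moduli of continuity for the gradient, and first-order expansion of [phi] *)

Lemma compact_slab M : compact (`[0, T] `*` [set z : 'cV[R]_nx | `|z| <= M]).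
Proof. by apply: compact_setX; [exact: segment_compact|exact: compact_ball_cV]. Qed.

Lemma gphi_within M :
  {within `[0, T] `*` [set z : 'cV[R]_nx | `|z| <= M], continuous (fun tz : R * 'cV[R]_nx => gphi tz.1 tz.2)}.
Proof. by apply: continuous_subspaceW cgphi => -[t z] /= []. Qed.

Lemma gphi_bound M : exists2 B : R, 0 < B &
  forall t z, t \in `[0, T] -> `|z| <= M -> `|gphi t z| <= B.
Proof.
have [B B0 h] := compact_bound (@compact_slab M) (@gphi_within M).
by exists B => // t z t0 zM; apply: (h (t, z)); split.
Qed.

(** As [phi] is only C^1, [gphi] need not be Lipschitz; compactness of the slab over a ball supplies
    a modulus of continuity, which composition with [G] preserves. *)
Lemma unif_cont_gphi (W : normedModType R) (G : 'cV[R]_nx * 'cV[R]_nx -> W) M e :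
  ball_lip G -> 0 < e -> exists2 d : R, 0 < d & forall t t' z z',
    t \in `[0, T] -> t' \in `[0, T] -> `|z| <= M -> `|z'| <= M ->
    `|t - t'| <= d -> `|z - z'| <= d -> `|G (z, gphi t z) - G (z', gphi t' z')| <= e.
Proof.
move=> bG e0; have [B B0 piB] := gphi_bound M.
have [L L0 GL] := bG (Num.max M B).
have e10 : 0 < e / (L + 1) by rewrite divr_gt0 // ltr_wpDl.
have [d d0 hd] := compact_unif_cont (@compact_slab M) (@gphi_within M) e10.
exists (Num.min d (e / (L + 1))); first by rewrite lt_min d0.
move=> t t' z z' tT t'T zM z'M; rewrite !le_min => /andP[tt _] /andP[zz zze].
have pipi : `|gphi t z - gphi t' z'| <= e / (L + 1).
  by apply: (hd (t, z) (t', z')); rewrite ?prod_normE /= ?ge_max ?tt.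
apply: le_trans (GL _ _ _ _) _; rewrite ?prod_normE /= ?ge_max ?le_max ?zM ?z'M ?piB ?orbT //.
have : `|(z, gphi t z) - (z', gphi t' z')| <= e / (L + 1).
  by rewrite prod_normE /= ge_max zze.
move=> /(ler_wpM2l L0) /le_trans; apply.
rewrite mulrA ler_pdivrMr ?ltr_wpDl // mulrC ler_pM2l //.
by rewrite lerDl.
Qed.

(** The mean value theorem for [phi] in time and space, the time derivative being replaced through
    the HJB equation. Since [t != t'], the interior of the chord has times in ]0, T[, even when the
    chord starts or ends at the boundary. *)
Lemma chord t t' z z' : t \in `[0, T] -> t' \in `[0, T] -> t != t' ->
  exists2 s : R, 0 < s < 1 &
    phi t' z' - phi t z =
      - (t' - t) * min_hamiltonian P (z + s *: (z' - z)) (gphi (t + s * (t' - t)) (z + s *: (z' - z)))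
      + dot (gphi (t + s * (t' - t)) (z + s *: (z' - z))) (z' - z).
Proof.
rewrite !in_itv /= => /andP[t0 tT] /andP[t'0 t'T] tt'.
have inT s : 0 < s < 1 -> t + s * (t' - t) \in `]0, T[.
  move=> /andP[s0 s1]; rewrite in_itv /=; apply/andP.
  by case: (ltgtP t t') tt' => // tt _; split; nra.
have [||s s01] := MVT_ray (z := (t, z)) (v := (t' - t, z' - z)) cphi.
- move=> s /andP[s0 s1]; split => //=; rewrite in_itv /=.
  by apply/andP; split; rewrite /GRing.scale /=; nra.
- by move=> s s01; apply: dphi; exact: inT.
rewrite /= !subrKC => ->; exists s => //.
have ts := inT _ s01.
by rewrite derive_uncurry; last exact: dphi; rewrite HJB // derive_grad ?gphiE ?mulrN ?mulNr //; apply/differentiable_snd/dphi.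
Qed.

Lemma phi_time_cont t z e : t \in `[0, T] -> 0 < e ->
  exists2 d : R, 0 < d & forall t', t' \in `[0, T] -> `|t - t'| < d ->
    `|phi t z - phi t' z| < e.
Proof.
move=> tT e0; have [d d0 h] := (within_continuousP _ _).1 cphi (t, z) (conj tT I) e e0.
exists d => // t' t'T tt; apply: (h (t', z)) => //.
by rewrite prod_normE /= subrr normr0 gt_max tt.
Qed.

Lemma near_time t (d : R) : t \in `[0, T] -> 0 < d ->
  exists t' : R, [/\ t' \in `[0, T], t != t' & `|t - t'| < d].
Proof.
rewrite in_itv /= => /andP[t0 tT] d0.
have [tlt|tge] := ltP t T.
  exists (Num.min T (t + d / 2)); rewrite in_itv /=.
  have [h|h] := leP T (t + d / 2).
    by split; [lra|rewrite lt_eqF|rewrite ltr_norml; lra].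
  by split; [lra|rewrite lt_eqF //; lra|rewrite ltr_norml; lra].
exists (Num.max 0 (t - d / 2)); rewrite in_itv /=.
have [h|h] := leP 0 (t - d / 2).
  by split; [lra|rewrite gt_eqF //; lra|rewrite ltr_norml; lra].
split; [lra|by rewrite gt_eqF // (lt_le_trans T_gt0)|rewrite ltr_norml; lra].
Qed.

(** The chord formula, with the gradient at the intermediate point moved back to the base point by
    uniform continuity. The expansion is uniform on balls and valid up to the times 0 and T. *)
Lemma unif_diff_phi M e : 0 < e -> exists2 d : R, 0 < d & forall t t' z z',
    t \in `[0, T] -> t' \in `[0, T] -> `|z| <= M -> `|z'| <= M ->
    `|t' - t| <= d -> `|z' - z| <= d ->
    `|phi t' z' - phi t z + (t' - t) * min_hamiltonian P z (gphi t z)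
      - dot (gphi t z) (z' - z)| <= e * (`|t' - t| + `|z' - z|).
Proof.
(* The factor [nx] is the cost of [dot_norm_le]; adding 1 covers [nx = 0]. *)
move=> e0; have e10 : 0 < e / (nx%:R + 1) by rewrite divr_gt0 // ltr_wpDl.
have [d1 d10 h1] := unif_cont_gphi M (ball_lip_min_hamiltonian A2) e0.
have [d2 d20 h2] := unif_cont_gphi M (@ball_lip_snd _ _ _) e10.
pose d := Num.min d1 d2.
have d0 : 0 < d by rewrite lt_min d10.
have main t t' z z' : t \in `[0, T] -> t' \in `[0, T] -> t != t' -> `|z| <= M -> `|z'| <= M ->
    `|t' - t| <= d -> `|z' - z| <= d ->
    `|phi t' z' - phi t z + (t' - t) * min_hamiltonian P z (gphi t z)
      - dot (gphi t z) (z' - z)| <= e * (`|t' - t| + `|z' - z|).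
  move=> tT t'T tt' zM z'M ttd zzd.
  have [s /andP[s0 s1] ->] := chord z z' tT t'T tt'.
  set zs := z + _; set ts := t + _.
  have zsM : `|zs| <= M by apply: norm_ray_le => //; rewrite !ltW.
  have tsT : ts \in `[0, T].
    by move: tT t'T; rewrite !in_itv /= /ts => /andP[? ?] /andP[? ?]; apply/andP; split; nra.
  have sd (W : normedModType R) (w : W) : `|w| <= d -> `|s *: w| <= d.
    by move=> wd; rewrite normrZ (gtr0_norm s0); apply: le_trans wd; rewrite ler_piMl // ltW.
  have tsd : `|ts - t| <= d by rewrite /ts addrAC subrr add0r; exact: (sd R^o).
  have zsd : `|zs - z| <= d by rewrite /zs addrAC subrr add0r; exact: sd.
  have := h1 _ _ _ _ tsT tT zsM zM; have := h2 _ _ _ _ tsT tT zsM zM; rewrite /=.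
  move: tsd zsd; rewrite !le_min => /andP[-> ->] /andP[-> ->].
  move=> /(_ isT isT) H2 /(_ isT isT) H1.
  rewrite (_ : _ - _ = - ((t' - t) * (min_hamiltonian P zs (gphi ts zs) - min_hamiltonian P z (gphi t z)))
     + dot (gphi ts zs - gphi t z) (z' - z)); last by rewrite dotBl; ring.
  apply: le_trans (ler_normD _ _) _; rewrite normrN normrM mulrDr; apply: lerD.
    by rewrite mulrC; exact: ler_wpM2r.
  apply: le_trans (dot_norm_le _ _) _; apply: ler_wpM2r => //.
  apply: le_trans (ler_wpM2l _ H2) _ => //.
  by rewrite mulrA ler_pdivrMr ?ltr_wpDl // mulrC ler_pM2l // lerDl.
exists d => // t t' z z' tT t'T zM z'M ttd zzd.
(* [t] may be an end point, where [phi] need not be differentiable: approximate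
   [t] by other times. *)
have [tt|tt'] := eqVneq t t'; last exact: main.
apply/ler_addgt0Pr => c c0; rewrite -tt in ttd *.
set mh := min_hamiltonian _ _ _.
have k0 : 0 < c / 2 by rewrite divr_gt0.
have [d3 d30 h3] := phi_time_cont z' tT k0.
(* Moving [t] to [t''] costs at most [c / 2] by continuity of [phi], plus (e + |mh|) |t - t''|,
   which [d4] keeps below [c / 2]. *)
pose d4 := Num.min d (Num.min d3 (c / 2 / (e + `|mh| + 1))).
have d40 : 0 < d4 by rewrite lt_min d0 lt_min d30 /= divr_gt0 // ltr_wpDl // addr_ge0 // ltW.
have [t'' [t''T tt'' t''d]] := near_time tT d40.
have := t''d; rewrite lt_min => /andP[dd]; rewrite lt_min => /andP[dd3 dd4].
have := main t t'' z z' tT t''T tt'' zM z'M; rewrite [`|t'' - t|]distrC (ltW dd).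
move=> /(_ isT zzd) H; have := h3 _ t''T dd3; rewrite distrC => H3.
have K : (e + `|mh|) * `|t - t''| <= c / 2.
  have p1 : 0 < e + `|mh| + 1 by rewrite ltr_wpDl // addr_ge0 // ltW.
  move: dd4; rewrite ltr_pdivlMr // mulrC => /ltW; apply: le_trans.
  by rewrite ler_wpM2r // lerDl.
rewrite subrr normr0 add0r mul0r addr0.
rewrite (_ : _ - _ - _ = (phi t'' z' - phi t z + (t'' - t) * mh - dot (gphi t z) (z' - z))
   - ((phi t'' z' - phi t z') + (t'' - t) * mh)); last by ring.
apply: le_trans (ler_normB _ _) _.
have H4 : `|phi t'' z' - phi t z' + (t'' - t) * mh| <= c / 2 + `|mh| * `|t - t''|.
  apply: le_trans (ler_normD _ _) _; apply: lerD; first exact: ltW.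
  by rewrite normrM [X in X * _]distrC mulrC.
have := lerD H H4; move=> /le_trans; apply; move: K; lra.
Qed.

(** * The co-state equation for the gradient, in discrete form *)

Lemma derive_hamiltonian_scale z p v i (rho : R) :
  'D_(rho *: delta_mx i 0) (fun y => hamiltonian P y p v) z =
  rho * 'D_(delta_mx i 0) (fun y => hamiltonian P y p v) z.
Proof.
have dH := differentiable_hamiltonian A2 z p v.
by rewrite !deriveE // linearZ.
Qed.

(* The HJB inequality along a step of the translated trajectory, minus the HJB
   equality along the step itself: the control [feedback P z (gphi t z)] is kept,
   and it is optimal only for [rho = 0].  The time step [c] may be negative. *)
Lemma costate_step M e : 0 <= M -> 0 < e -> exists2 rho0 : R, 0 < rho0 & exists2 d : R, 0 < d &
  forall (rho : R) i, `|rho| = rho0 ->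
  let Phi := fun t z => phi t (z + rho *: delta_mx i 0) - phi t z in
  (forall t z, t \in `[0, T] -> `|z| <= M ->
    `|Phi t z - rho * gphi t z i 0| <= rho0 * e) /\
  (forall t (c : R) z z', t \in `[0, T] -> t + c \in `[0, T] -> c != 0 -> `|c| <= d ->
    `|z| <= M -> `|z'| <= M ->
    `|z' - z - c *: closed_velocity P z (gphi t z)| <= `|c| * d ->
    - (rho * costate_rate P z (gphi t z) i 0) - rho0 * e <= c^-1 * (Phi (t + c) z' - Phi t z)).
Proof.
move=> M0 e0.
have [Bp Bp0 hBp] := gphi_bound (M + 1).
have [B B0 hB] := ball_lip_bound (Num.max (M + 1) Bp) (ball_lip_closed_velocity A2).
have [Bv Bv0 hBv] := ball_lip_bound (Num.max (M + 1) Bp) (ball_lip_feedback A2).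
have e40 : 0 < e / 4 by rewrite divr_gt0.
have /choice [L hL] : forall i : 'I_nx, exists L : R, 0 <= L /\
    forall z z' p p' v, `|z| <= M + 1 -> `|z'| <= M + 1 -> `|p| <= Bp -> `|p'| <= Bp -> `|v| <= Bv ->
    `|'D_(delta_mx i 0) (fun y => hamiltonian P y p v) z -
      'D_(delta_mx i 0) (fun y => hamiltonian P y p' v) z'| <= L * Num.max `|z - z'| `|p - p'|.
  move=> i; have [L L0 h] := ball_lip_derive_hamiltonian A2 i (Num.max (M + 1) (Num.max Bp Bv)).
  exists L; split => // z z' p p' v zM z'M pM p'M vM.
  have := h (z, (p, v)) (z', (p', v)).
  rewrite !prod_normE /= !ge_max !le_max zM z'M pM p'M vM !orbT /= => /(_ isT isT).
  by rewrite subrr normr0 (@max_l _ _ `|p - p'|).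
have L0 i : 0 <= L i by case: (hL i).
have sL0 : 0 <= \sum_i L i by apply: sumr_ge0.
have [e3 e30 he3] := small_factor sL0 e40.
have [d1 d10 h1] := unif_cont_gphi (M + 1) (@ball_lip_snd _ _ _) e30.
have [d2 d20 h2] := unif_diff_phi (M + 1) e0.
pose rho0 := Num.min 1 (Num.min e3 (Num.min d1 d2)).
have rho00 : 0 < rho0 by rewrite !lt_min ltr01 e30 d10.
have [r1 r3 rd1 rd2] : [/\ rho0 <= 1, rho0 <= e3, rho0 <= d1 & rho0 <= d2].
  by split; rewrite !ge_min lexx ?orbT.
(* The remainders of the time step must be small against the shift [rho0], not only against [e];
   hence [rho0] is fixed first and [d] depends on it. *)
have re0 : 0 < rho0 * e / 4 by rewrite divr_gt0 // mulr_gt0.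
have K10 : 0 <= 2 * (B + 2) by rewrite mulr_ge0 // addr_ge0 // ltW.
have [e1 e10 he1] := small_factor K10 re0.
have [d3 d30 h3] := unif_diff_phi (M + 1) e10.
have K20 : 0 <= nx%:R * (Bp + Bp) by rewrite mulr_ge0 // addr_ge0 // ltW.
have [d4 d40 hd4] := small_factor K20 re0.
have B10 : 0 <= B + 1 by rewrite addr_ge0 // ltW.
have [d5 d50 hd5] := small_factor B10 d30.
pose d := Num.min 1 (Num.min d3 (Num.min d4 d5)).
have d0 : 0 < d by rewrite !lt_min ltr01 d30 d40.
have [c1 c3 c4 c5] : [/\ d <= 1, d <= d3, d <= d4 & d <= d5].
  by split; rewrite !ge_min lexx ?orbT.
exists rho0 => //; exists d => // rho i rhoE Phi.
pose h : 'cV[R]_nx := rho *: delta_mx i 0.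
have hr : `|h| <= rho0.
  by rewrite /h normrZ rhoE ler_piMr ?norm_delta_mx_le // ltW.
have hM z : `|z| <= M -> `|z + h| <= M + 1.
  by move=> zM; apply: le_trans (ler_normD _ _) _; apply: lerD => //; exact: le_trans hr r1.
have wM z : `|z| <= M -> `|z| <= M + 1 by move=> zM; rewrite ler_wpDr.
split.
  move=> t z tT zM.
  have := h2 t t z (z + h) tT tT (wM _ zM) (hM _ zM).
  rewrite subrr normr0 addrAC subrr add0r mul0r addr0 dotZr dot_delta.
  move=> /(_ (ltW d20) (le_trans hr rd2)) /le_trans; apply.
  by rewrite add0r mulrC ler_wpM2r // ltW.
move=> t c z z' tT tcT cn0 cd zM z'M step.
set p := gphi t z; set b := closed_velocity P z p in step *.
set v := feedback P z p; set ph := gphi t (z + h).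
have c0 : 0 < `|c| by rewrite normr_gt0.
have pB : `|p| <= Bp by apply: hBp => //; exact: wM.
have phB : `|ph| <= Bp by apply: hBp => //; exact: hM.
have bB : `|b| <= B by apply: (hB (z, p)); rewrite prod_normE /= ge_max !le_max pB (wM _ zM) orbT.
have vB : `|v| <= Bv by apply: (hBv (z, p)); rewrite prod_normE /= ge_max !le_max pB (wM _ zM) orbT.
have wB : `|z' - z| <= `|c| * (B + 1).
  rewrite -(subrK (c *: b) (z' - z)); apply: le_trans (ler_normD _ _) _.
  rewrite mulrDr mulr1 addrC normrZ; apply: lerD; first exact: ler_wpM2l.
  by apply: le_trans step _; rewrite ler_piMr // ltW.
have wd3 : `|z' - z| <= d3.
  apply: le_trans wB _; apply: le_trans hd5; rewrite mulrC; apply: ler_wpM2l => //.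
  exact: le_trans cd c5.
have cd3 : `|t + c - t| <= d3 by rewrite addrAC subrr add0r; exact: le_trans cd c3.
have ud : e1 * (`|t + c - t| + `|z' - z|) <= `|c| * (e1 * (B + 2)).
  rewrite addrAC subrr add0r mulrCA ler_pM2l // (_ : B + 2 = 1 + (B + 1)); last by ring.
  by rewrite [leRHS]mulrDr mulr1; apply: lerD.
have U1 := le_trans (h3 t (t + c) z z' tT tcT (wM _ zM) (wM _ z'M) cd3 wd3) ud.
have shift_h : z' + h - (z + h) = z' - z by rewrite opprD addrACA subrr addr0.
have U2 := h3 t (t + c) (z + h) (z' + h) tT tcT (hM _ zM) (hM _ z'M) cd3.
rewrite shift_h in U2; have {}U2 := le_trans (U2 wd3) ud.
have pph : `|ph - p| <= e3.
  apply: (h1 t t (z + h) z) => //; [exact: hM|exact: wM|by rewrite subrr normr0 ltW|].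
  by rewrite addrAC subrr add0r; exact: le_trans hr rd1.
have dotr : `|dot (ph - p) (z' - z - c *: b)| <= `|c| * (rho0 * e / 4).
  apply: le_trans (dot_norm_le _ _) _.
  have bp : `|ph - p| <= Bp + Bp by apply: le_trans (ler_normB _ _) _; exact: lerD.
  have := ler_pM _ _ (ler_wpM2l (ler0n R nx) bp) step => /(_ (mulr_ge0 _ _) _) /le_trans; apply => //.
  rewrite mulrCA ler_pM2l //; apply: le_trans hd4; exact: ler_wpM2l.
(* Only the state moves here: the co-state [ph] and the control [v] stay fixed. *)
have [s s01 mvt] := MVT_ray (A := setT) (z := z) (v := h)
  (F := fun y => hamiltonian P y ph v)
  (continuous_subspaceT (fun y => differentiable_continuous (differentiable_hamiltonian A2 y ph v)))
  (fun _ _ => I) (fun _ _ => differentiable_hamiltonian A2 _ ph v).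
have shr : `|s *: h| <= rho0.
  case/andP: s01 => s0 s1; rewrite normrZ (gtr0_norm s0); apply: le_trans hr.
  by rewrite ler_piMl // ltW.
have Hdiff : hamiltonian P (z + h) ph v - hamiltonian P z ph v <=
    rho * costate_rate P z p i 0 + rho0 * (e / 4).
  rewrite mvt derive_hamiltonian_scale costate_rateE -/v -lerBlDl -mulrBr.
  apply: le_trans (ler_norm _) _; rewrite normrM rhoE ler_pM2l //.
  have [_ hLi] := hL i; apply: le_trans (hLi _ _ _ _ _ _ _ _ _ _) _ => //.
  - apply: le_trans (ler_normD _ _) _; apply: lerD => //; exact: le_trans shr r1.
  - exact: wM.
  apply: le_trans he3; apply: ler_pM => //.
    by rewrite (bigD1 i) //= lerDl sumr_ge0.
  by rewrite ge_max pph andbT addrAC subrr add0r (le_trans shr).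
(* Here equality is lost: [v] is a mere competitor in the minimum at [z + h], whereas at [z], with
   co-state [p], it attains the minimum. *)
have mhle : min_hamiltonian P (z + h) ph <= hamiltonian P (z + h) ph v.
  exact: min_hamiltonian_le.
have mhE : min_hamiltonian P z p = hamiltonian P z ph v - dot (ph - p) b.
  by rewrite (hamiltonian_shift _ z ph p v) addrK.
have tc : t + c - t = c by rewrite addrAC subrr add0r.
rewrite tc -/p -/ph in U1 U2.
set X1 := phi (t + c) z' - _ + _ - _ in U1.
set X2 := phi (t + c) (z' + h) - _ + _ - _ in U2.
pose X := X2 - X1 + dot (ph - p) (z' - z - c *: b).
(* [X] gathers all remainders; it is bounded by a multiple of |c|, so that dividing by [c] is
   harmless for either sign. The term with [b] cancels against the change of co-state in [mhE]. *)
have XE : Phi (t + c) z' - Phi t z = X -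
    c * (min_hamiltonian P (z + h) ph - min_hamiltonian P z p - dot (ph - p) b).
  by rewrite /X /X1 /X2 /Phi -/h [dot _ (_ - c *: b)]dotBr dotZr !dotBl; ring.
have XB : `|X| <= `|c| * (rho0 * e / 2).
  apply: le_trans (ler_normD _ _) _; apply: le_trans (lerD (ler_normB _ _) dotr) _.
  apply: le_trans (lerD (lerD U2 U1) (lexx _)) _.
  by rewrite -!mulrDr ler_pM2l //; move: he1; clear - T_gt0 A1 A2 cphi dphi cgphi gphiE HJB; lra.
have cX : - (rho0 * e / 2) <= c^-1 * X.
  have : `|c^-1 * X| <= rho0 * e / 2.
    by rewrite normrM normfV mulrC ler_pdivrMr // mulrC.
  by rewrite ler_norml => /andP[].
have cXE : c^-1 * (Phi (t + c) z' - Phi t z) = c^-1 * X -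
    (min_hamiltonian P (z + h) ph - hamiltonian P z ph v).
  by rewrite XE mhE mulrBr mulKf //; ring.
rewrite cXE; move: re0 cX Hdiff mhle.
clear - T_gt0 A1 A2 cphi dphi cgphi gphiE HJB; lra.
Qed.

(** Sums [costate_step] over the polygon; the shifts [rho0] and [- rho0] give the two opposite
    inequalities. *)
Lemma discrete_costate M e : 0 <= M -> 0 < e -> exists2 d : R, 0 < d &
  forall (t0 c : R) (y : nat -> 'cV[R]_nx) N,
    let p := fun k => gphi (t0 + k%:R * c) (y k) in
    c != 0 -> `|c| <= d -> N%:R * `|c| <= T ->
    (forall k, (k <= N)%N -> t0 + k%:R * c \in `[0, T] /\ `|y k| <= M) ->
    (forall k, (k < N)%N ->
      `|y k.+1 - y k - c *: closed_velocity P (y k) (p k)| <= `|c| * d) ->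
    forall k, (k <= N)%N ->
      `|p k - p 0%N + c *: \sum_(j < k) costate_rate P (y j) (p j)| <= e.
Proof.
move=> M0 e0.
(* [T] pays for the steps, and 2 for replacing the shift difference [Phi] by [rho * p] at both ends
   of the polygon. *)
have K0 : 0 <= T + 2 by rewrite addr_ge0 // ltW.
have [e1 e10 he1] := small_factor K0 e0.
have [rho0 rho00 [d d0 hd]] := costate_step M0 e10.
exists d => // t0 c y N p cn0 cd NT yM ystep k kN.
apply: norm_le_coord => [|i j]; first exact: ltW.
rewrite (ord1 j) {j} !mxE summxE.
have c0 : 0 < `|c| by rewrite normr_gt0.
have one (rho : R) : `|rho| = rho0 ->
    - (`|c| * k%:R + 2) * (rho0 * e1) <= `|c| * (c^-1 * (rho * (p k i 0 - p 0%N i 0))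
      + rho * \sum_(j < k) costate_rate P (y j) (p j) i 0).
  move=> rhoE; have [hd1 hd2] := hd rho i rhoE.
  pose Phi := fun t z => phi t (z + rho *: delta_mx i 0) - phi t z.
  have S m : (m <= N)%N -> - (rho * \sum_(j < m) costate_rate P (y j) (p j) i 0) - m%:R * (rho0 * e1)
      <= c^-1 * (Phi (t0 + m%:R * c) (y m) - Phi (t0 + 0%:R * c) (y 0%N)).
    elim: m => [|m IH] mN; first by rewrite big_ord0 subrr !mulr0 mul0r subr0 oppr0.
    have tE : t0 + m.+1%:R * c = t0 + m%:R * c + c by rewrite -addrA -[m.+1]addn1 natrD mulrDl mul1r.
    have [mT ymM] := yM m (ltnW mN); have [m1T ym1M] := yM _ mN.
    rewrite tE in m1T *.
    have mS : m.+1%:R = m%:R + 1 :> R by rewrite -addn1 natrD.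
    have H2 : - (rho * costate_rate P (y m) (p m) i 0) - rho0 * e1 <=
        c^-1 * (Phi (t0 + m%:R * c + c) (y m.+1) - Phi (t0 + m%:R * c) (y m)).
      exact: hd2 _ c _ _ mT m1T cn0 cd ymM ym1M (ystep _ mN).
    by move: H2 (IH (ltnW mN)); rewrite big_ord_recr /= mS; clear - T_gt0 A1 A2 cphi dphi cgphi gphiE HJB; lra.
  have [kT ykM] := yM k kN; have [T0 y0M] := yM 0%N (leq0n _).
  have Hk : `|Phi (t0 + k%:R * c) (y k) - rho * p k i 0| <= rho0 * e1 := hd1 _ _ kT ykM.
  have H0 : `|Phi (t0 + 0%:R * c) (y 0%N) - rho * p 0%N i 0| <= rho0 * e1 := hd1 _ _ T0 y0M.
  have := S k kN.
  set Sk := \sum_(j < k) _; set F0 := Phi _ (y 0%N) in H0 *; set Fk := Phi _ (y k) in Hk *.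
  move=> HS; have D : `|(Fk - F0) - rho * (p k i 0 - p 0%N i 0)| <= 2 * (rho0 * e1).
    rewrite (_ : _ - _ = (Fk - rho * p k i 0) - (F0 - rho * p 0%N i 0)); last by ring.
    by apply: le_trans (ler_normB _ _) _; move: H0 Hk; clear - T_gt0 A1 A2 cphi dphi cgphi gphiE HJB; lra.
  have D2 : `|c| * (c^-1 * (Fk - F0) - c^-1 * (rho * (p k i 0 - p 0%N i 0))) <= 2 * (rho0 * e1).
    rewrite -mulrBr; apply: le_trans (ler_norm _) _.
    by rewrite !normrM normr_id normfV mulVKf ?gt_eqF.
  by have := ler_wpM2l (normr_ge0 c) HS; move: D2; clear - T_gt0 A1 A2 cphi dphi cgphi gphiE HJB; lra.
pose D := c^-1 * (p k i 0 - p 0%N i 0) + \sum_(j < k) costate_rate P (y j) (p j) i 0.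
have kc : `|c| * k%:R <= T.
  by apply: le_trans NT; rewrite mulrC ler_wpM2r // ler_nat.
have bound : `|c| * `|D| <= e.
  apply: le_trans he1.
  have h1 := one rho0 (gtr0_norm rho00).
  have h2 : `|- rho0| = rho0 by rewrite normrN gtr0_norm.
  have {}h2 := one (- rho0) h2.
  have f1 : - (`|c| * k%:R + 2) * e1 <= `|c| * D.
    rewrite -(ler_pM2l rho00) (le_trans _ (le_trans h1 _)) //; rewrite /D; clear - T_gt0 A1 A2 cphi dphi cgphi gphiE HJB; lra.
  have f2 : - (`|c| * k%:R + 2) * e1 <= - (`|c| * D).
    rewrite -(ler_pM2l rho00) (le_trans _ (le_trans h2 _)) //; rewrite /D; clear - T_gt0 A1 A2 cphi dphi cgphi gphiE HJB; lra.
  have f3 : (`|c| * k%:R + 2) * e1 <= (T + 2) * e1 by rewrite ler_wpM2r ?lerD // ltW.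
  rewrite -[X in X * _]normr_id -normrM ler_norml; move: f1 f2 f3; clear - T_gt0 A1 A2 cphi dphi cgphi gphiE HJB; lra.
apply: le_trans bound; rewrite -normrM /D mulrDr mulrA divff // mul1r.
exact: lexx.
Qed.

(* The time span [dl] is so short that L dl <= 1/2, L being a Lipschitz constant:
   the bound [e] then propagates by strong induction, without exponential growth. *)
Lemma compare_extremals (M : R) (x q : R -> 'cV[R]_nx) :
  0 <= M -> (forall t, t \in `[0, T] -> `|x t| <= M /\ `|q t| <= M) ->
  unif_diff T x (fun t => closed_velocity P (x t) (q t)) ->
  unif_diff T q (fun t => - costate_rate P (x t) (q t)) ->
  exists2 dl : R, 0 < dl & forall e : R, 0 < e -> exists2 d : R, 0 < d &
    forall (t0 c : R) (y : nat -> 'cV[R]_nx) N,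
    let p := fun k => gphi (t0 + k%:R * c) (y k) in
    c != 0 -> `|c| <= d -> N%:R * `|c| <= dl ->
    (forall k, (k <= N)%N -> t0 + k%:R * c \in `[0, T] /\ `|y k| <= M) ->
    (forall k, (k < N)%N ->
      `|y k.+1 - y k - c *: closed_velocity P (y k) (p k)| <= `|c| * d) ->
    y 0%N = x t0 -> p 0%N = q t0 ->
    forall k, (k <= N)%N -> `|y k - x (t0 + k%:R * c)| <= e /\ `|p k - q (t0 + k%:R * c)| <= e.
Proof.
move=> M0 xqM udx udq.
have [Bp Bp0 hBp] := gphi_bound M.
have [L1 L10 hL1] := ball_lip_closed_velocity A2 (Num.max M Bp).
have [L2 L20 hL2] := ball_lip_costate_rate A2 (Num.max M Bp).
pose L := Num.max L1 L2.
have L0 : 0 <= L by rewrite le_max L10.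
have h20 : 0 < 2^-1 :> R by rewrite invr_gt0.
have [dl1 dl10 hdl1] := small_factor L0 h20.
(* The span is also kept below [T] because the grid estimates [unif_diff_sum] and [discrete_costate]
   assume it. *)
exists (Num.min dl1 T); first by rewrite lt_min dl10.
move=> e e0; have e40 : 0 < e / 4 by rewrite divr_gt0.
have [d1 d10 h1] := unif_diff_sum T_gt0 udx e40.
have [d2 d20 h2] := unif_diff_sum T_gt0 udq e40.
have [d3 d30 h3] := discrete_costate M0 e40.
have [d4 d40 hd4] := small_factor (ltW T_gt0) e40.
pose d := Num.min (Num.min d1 d2) (Num.min d3 d4).
have d0 : 0 < d by rewrite !lt_min d10 d20 d30.
have [dd1 dd2 dd3 dd4] : [/\ d <= d1, d <= d2, d <= d3 & d <= d4].
  by split; rewrite !ge_min lexx ?orbT.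
exists d => // t0 c y N p cn0 cd; rewrite le_min => /andP[Ndl NT] yM step y0 p0.
have tT k : (k <= N)%N -> t0 + k%:R * c \in `[0, T] by move=> /yM [].
have step3 k : (k < N)%N -> `|y k.+1 - y k - c *: closed_velocity P (y k) (p k)| <= `|c| * d3.
  by move=> /step /le_trans; apply; exact: ler_wpM2l.
have cost := h3 t0 c y N cn0 (le_trans cd dd3) NT yM step3.
have xs := h1 t0 c N (le_trans cd dd1) NT tT.
have qs := h2 t0 c N (le_trans cd dd2) NT tT.
have ys k : (k <= N)%N ->
    `|y k - y 0%N - c *: \sum_(j < k) closed_velocity P (y j) (p j)| <= e / 4.
  move=> kN; apply: le_trans (telescope_le step kN) _.
  apply: le_trans hd4; rewrite mulrA; apply: ler_pM => //.
  - exact: ltW.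
  - by apply: le_trans NT; rewrite ler_wpM2r // ler_nat.
have sumL n (F G : nat -> 'cV[R]_n) k : (k <= N)%N ->
    (forall j, (j < k)%N -> `|F j - G j| <= L * e) ->
    `|c *: \sum_(j < k) F j - c *: \sum_(j < k) G j| <= e / 2.
  move=> kN FG; rewrite -scalerBr -sumrB normrZ.
  have S := @ler_sum_const _ _ (fun j => F j - G j) k _ FG.
  apply: le_trans (ler_wpM2l (normr_ge0 c) S) _.
  have kc : k%:R * `|c| <= dl1 by apply: le_trans Ndl; rewrite ler_wpM2r // ler_nat.
  have := ler_wpM2l L0 kc; move=> /le_trans /(_ hdl1) /(ler_wpM2r (ltW e0)).
  by clear - T_gt0 A1 A2 cphi dphi cgphi gphiE HJB; lra.
(* Budget: [e / 4] for the defect of each of the two sequences and [e / 2] for the difference of the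
   sums, since all earlier errors are at most [e]. *)
elim/ltn_ind => k IH kN.
have close j : (j < k)%N -> `|(y j, p j) - (x (t0 + j%:R * c), q (t0 + j%:R * c))| <= e.
  move=> jk; have [E1 E2] := IH j jk (leq_trans (ltnW jk) kN).
  by rewrite prod_normE /= ge_max E1.
have inB j : (j < k)%N -> `|(y j, p j)| <= Num.max M Bp /\
    `|(x (t0 + j%:R * c), q (t0 + j%:R * c))| <= Num.max M Bp.
  move=> jk; have [jT jM] := yM j (leq_trans (ltnW jk) kN); have [xM qM] := xqM _ jT.
  by rewrite !prod_normE /= !ge_max !le_max xM qM jM hBp // !orbT.
have D1 := @sumL _ (fun j => closed_velocity P (y j) (p j))
  (fun j => closed_velocity P (x (t0 + j%:R * c)) (q (t0 + j%:R * c))) k kN.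
have D2 := @sumL _ (fun j => costate_rate P (y j) (p j))
  (fun j => costate_rate P (x (t0 + j%:R * c)) (q (t0 + j%:R * c))) k kN.
split.
  rewrite (subr_decompose _ _ (x t0) (c *: \sum_(j < k) closed_velocity P (y j) (p j))
    (c *: \sum_(j < k) closed_velocity P (x (t0 + j%:R * c)) (q (t0 + j%:R * c)))).
  have := ys k kN; rewrite y0 => {}ys.
  apply: le_trans (ler_normD _ _) _.
  apply: le_trans (lerD (le_trans (ler_normB _ _) (lerD ys (xs k kN))) (D1 _)) _; last first.
    by clear - T_gt0 A1 A2 cphi dphi cgphi gphiE HJB; lra.
  move=> j jk; have [i1 i2] := inB j jk; apply: le_trans (hL1 _ _ i1 i2) _.
  by apply: ler_pM => //; [rewrite le_max lexx|exact: close].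
rewrite (subr_decompose _ _ (q t0) (- (c *: \sum_(j < k) costate_rate P (y j) (p j)))
  (c *: \sum_(j < k) - costate_rate P (x (t0 + j%:R * c)) (q (t0 + j%:R * c)))).
have := cost k kN; rewrite -/p -/(p 0%N) p0 => {}cost.
rewrite opprK [X in _ + (_ - X)](_ : _ = - (c *: \sum_(j < k) costate_rate P (x (t0 + j%:R * c)) (q (t0 + j%:R * c)))); last first.
  by rewrite sumrN scalerN.
rewrite -opprD.
apply: le_trans (ler_normB _ _) _.
apply: le_trans (lerD (le_trans (ler_normB _ _) (lerD cost (qs k kN))) (D2 _)) _; last first.
    by clear - T_gt0 A1 A2 cphi dphi cgphi gphiE HJB; lra.
move=> j jk; have [i1 i2] := inB j jk; apply: le_trans (hL2 _ _ i1 i2) _.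
by apply: ler_pM => //; [rewrite le_max lexx orbT|exact: close].
Qed.

(** * Identification of the co-state, and uniqueness for the closed loop *)

(** Explicit Euler scheme for the closed loop with [gphi] as co-state; a negative [c] runs it
    backwards. Its increments satisfy the step hypothesis of [compare_extremals] without error. *)
Fixpoint euler (t0 c : R) (y0 : 'cV[R]_nx) k : 'cV[R]_nx :=
  if k is k'.+1 then
    let y := euler t0 c y0 k' in y + c *: closed_velocity P y (gphi (t0 + k'%:R * c) y)
  else y0.

(** Runs backwards from T, where the two co-states agree. On a short span the polygon from [x t0]
    and [gphi] along it stay close to [(x, q)]; as the step tends to 0, continuity of [gphi] yields
    the equality at [t1], and such spans cover [0, T]. *)
Lemma costate_is_gradient (M : R) (x q : R -> 'cV[R]_nx) :
  0 <= M -> (forall t, t \in `[0, T] -> `|x t| <= M /\ `|q t| <= M) ->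
  unif_diff T x (fun t => closed_velocity P (x t) (q t)) ->
  unif_diff T q (fun t => - costate_rate P (x t) (q t)) ->
  q T = gphi T (x T) -> forall t, t \in `[0, T] -> q t = gphi t (x t).
Proof.
move=> M0 xqM udx udq qT.
(* The radius [M + 1] leaves room for the Euler polygon, which starts in the ball of radius [M]. *)
have xqM1 t : t \in `[0, T] -> `|x t| <= M + 1 /\ `|q t| <= M + 1.
  by move=> /xqM [? ?]; split; rewrite ler_wpDr.
have M10 : 0 <= M + 1 by rewrite addr_ge0.
have [dl dl0 hdl] := compare_extremals M10 xqM1 udx udq.
have [Bp Bp0 hBp] := gphi_bound (M + 1).
have [B B0 hB] := ball_lip_bound (Num.max (M + 1) Bp) (ball_lip_closed_velocity A2).
(* At speed at most [B], a span of [dl'] moves the polygon by at most 1. *)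
have [dl' dl'0 hdl'] := small_factor (ltW B0) (@ltr01 R).
have flip t : t \in `[0, T] -> T - t \in `[0, T].
  by rewrite !in_itv /= => /andP[? ?]; apply/andP; split; lra.
(* Time is reversed so that [interval_chain], which starts at 0, starts from the terminal
   condition. *)
suff H t : t \in `[0, T] -> q (T - t) = gphi (T - t) (x (T - t)).
  by move=> t /flip /H; rewrite subKr.
apply: (@interval_chain _ T (fun t => q (T - t) = gphi (T - t) (x (T - t))) (Num.min dl dl')).
- by rewrite lt_min dl0.
- by rewrite subr0.
move=> r s rT sT rs; rewrite le_min => /andP[rsdl rsdl'] Qr.
set t0 := T - r in Qr *; set t1 := T - s.
have t0T : t0 \in `[0, T] := flip _ rT; have t1T : t1 \in `[0, T] := flip _ sT.
apply/eqP; rewrite -subr_eq0; apply/eqP/norm_small_eq0 => e e0.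
have e20 : 0 < e / 2 by rewrite divr_gt0.
have [d1 d10 h1] := unif_cont_gphi (M + 1) (@ball_lip_snd _ _ _) e20.
have e30 : 0 < Num.min (e / 2) d1 by rewrite lt_min e20.
have [d d0 h] := hdl _ e30.
have [N N0 Nd] := fine_partition (t1 - t0) d0.
pose c := (t1 - t0) / N%:R; rewrite -/c in Nd.
have Nn0 : N%:R != 0 :> R by rewrite pnatr_eq0 -lt0n.
have NcE : N%:R * c = t1 - t0 by rewrite /c mulrC divfK.
have cN : N%:R * `|c| = s - r.
  rewrite -[N%:R]normr_nat -normrM NcE (_ : t1 - t0 = r - s) 1?distrC ?gtr0_norm ?subr_gt0 //.
  by rewrite /t1 /t0; ring.
have cn0 : c != 0.
  by apply/eqP => c0; move: cN; rewrite c0 normr0 mulr0 => /esym /eqP; rewrite subr_eq0 gt_eqF.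
pose y := euler t0 c (x t0).
have tkT k (kN : (k <= N)%N) := itv_grid t0T t1T NcE kN.
(* Displacement and speed are controlled together by induction: the bound [B] is known only while
   the polygon stays in the ball of radius [M + 1]. *)
have yk k : (k <= N)%N -> `|y k - x t0| <= k%:R * (`|c| * B).
  elim: k => [|k IH] kN; first by rewrite subrr normr0 mul0r.
  have {}IH := IH (ltnW kN).
  have ykM : `|y k| <= M + 1.
    rewrite -(subrK (x t0) (y k)) addrC (le_trans (ler_normD _ _)) //.
    apply: lerD; first by case: (xqM _ t0T).
    apply: le_trans IH _; apply: le_trans hdl'; rewrite mulrA mulrC.
    apply: ler_wpM2l; first exact: ltW.
    apply: le_trans rsdl'; rewrite -cN; apply: ler_wpM2r => //.
    by rewrite ler_nat ltnW.
  rewrite -natr1 mulrDl mul1r /= addrAC (le_trans (ler_normD _ _)) //.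
  apply: lerD => //; rewrite normrZ; apply: ler_wpM2l => //.
  apply: (hB (_, _)); rewrite prod_normE /= ge_max !le_max ykM /=.
  by rewrite hBp ?orbT //; apply: tkT; exact: ltnW.
have ykM k : (k <= N)%N -> `|y k| <= M + 1.
  move=> kN; rewrite -(subrK (x t0) (y k)) addrC (le_trans (ler_normD _ _)) //.
  apply: lerD; first by case: (xqM _ t0T).
  apply: le_trans (yk _ kN) _; apply: le_trans hdl'; rewrite mulrA mulrC.
  apply: ler_wpM2l; first exact: ltW.
  apply: le_trans rsdl'; rewrite -cN; apply: ler_wpM2r => //.
  by rewrite ler_nat.
have NT1 : t0 + N%:R * c = t1 by rewrite NcE subrKC.
have := h t0 c y N cn0 Nd; rewrite cN => /(_ rsdl).
move=> /(_ (fun k kN => conj (tkT k kN) (ykM k kN))) H.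
have [|||] := H _ _ _ N (leqnn N).
- move=> k kN.
  have -> : y k.+1 = y k + c *: closed_velocity P (y k) (gphi (t0 + k%:R * c) (y k)) by [].
  by rewrite [y k + _]addrC addrK subrr normr0 mulr_ge0 // ltW.
- by [].
- by rewrite mul0r addr0 Qr.
rewrite NT1 => E1 E2.
rewrite -(subrKA (gphi t1 (y N))) [e]splitr (le_trans (ler_normD _ _)) //.
apply: lerD; first by rewrite distrC (le_trans E2) // ge_min lexx.
apply: (h1 t1 t1 (y N) (x t1)) => //.
- exact: ykM.
- by case: (xqM1 _ t1T).
- by rewrite subrr normr0 ltW.
- by rewrite (le_trans E1) // ge_min lexx orbT.
Qed.

(** The comparison now runs forwards, with samples of [y] in place of an Euler polygon. At the start
    of each span [y] and [x] agree, hence so do the co-states, by [q = gphi] along [x]. *)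
Lemma closed_loop_unique (M : R) (x q y : R -> 'cV[R]_nx) :
  0 <= M -> (forall t, t \in `[0, T] -> `|x t| <= M /\ `|q t| <= M) ->
  (forall t, t \in `[0, T] -> `|y t| <= M) ->
  unif_diff T x (fun t => closed_velocity P (x t) (q t)) ->
  unif_diff T q (fun t => - costate_rate P (x t) (q t)) ->
  unif_diff T y (fun t => closed_velocity P (y t) (gphi t (y t))) ->
  (forall t, t \in `[0, T] -> q t = gphi t (x t)) ->
  y 0 = x 0 -> forall t, t \in `[0, T] -> y t = x t.
Proof.
move=> M0 xqM yM udx udq udy qgphi yx0.
have [dl dl0 hdl] := compare_extremals M0 xqM udx udq.
apply: (@interval_chain _ T (fun t => y t = x t) dl) => //.
move=> t0 t1 t0T t1T t01 t01dl Q0.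
apply/eqP; rewrite -subr_eq0; apply/eqP/norm_small_eq0 => e e0.
have [d d0 h] := hdl _ e0.
have [d' d'0 h'] := udy _ d0.
have dd0 : 0 < Num.min d d' by rewrite lt_min d0.
have [N N0 Nd] := fine_partition (t1 - t0) dd0.
pose c := (t1 - t0) / N%:R; rewrite -/c le_min in Nd; case/andP: Nd => Nd Nd'.
have Nn0 : N%:R != 0 :> R by rewrite pnatr_eq0 -lt0n.
have NcE : N%:R * c = t1 - t0 by rewrite /c mulrC divfK.
have c0 : 0 < c by rewrite divr_gt0 ?subr_gt0 ?ltr0n.
have tkT k (kN : (k <= N)%N) := itv_grid t0T t1T NcE kN.
have NT1 : t0 + N%:R * c = t1 by rewrite NcE subrKC.
have cn0 : c != 0 by rewrite gt_eqF.
have := h t0 c (fun k => y (t0 + k%:R * c)) N cn0 Nd.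
rewrite (gtr0_norm c0) NcE => /(_ t01dl (fun k kN => conj (tkT k kN) (yM _ (tkT k kN)))) H.
have [|||] := H _ _ _ N (leqnn N); last by rewrite NT1 => E1.
- move=> k kN; have := h' _ _ (tkT k (ltnW kN)) (tkT k.+1 kN).
  have -> : t0 + k.+1%:R * c - (t0 + k%:R * c) = c by rewrite -natr1; ring.
  by rewrite (gtr0_norm c0) in Nd' *; apply.
- by rewrite mul0r addr0.
- by rewrite mul0r addr0 Q0 qgphi.
Qed.

Lemma within_gradient (y : R -> 'cV[R]_nx) : {within `[0, T], continuous y} ->
  {within `[0, T], continuous (fun t => gphi t (y t))}.
Proof.
move=> cy; apply: (within_continuous_comp (g := fun t => (t, y t)) cgphi) => //.
by apply: within_pair => //; apply: continuous_subspaceT => t; exact: cvg_id.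
Qed.

(** Differentiability of [phi] is given only inside ]0, T[; the expansion [unif_diff_phi] with both
    times equal to T yields the limit of the difference quotients of [terminal_cost] directly. *)
Lemma terminal_gradient z : (forall z', phi T z' = terminal_cost P z') ->
  grad (terminal_cost P) z = gphi T z.
Proof.
move=> phiT; apply/matrixP => i j; rewrite (ord1 j) mxE.
apply: cvg_lim => //; apply/cvgrPdist_le => e e0.
have [d d0 h] := unif_diff_phi (`|z| + 1) e0.
have TT : T \in `[0, T] by rewrite in_itv /= lexx ltW.
near=> c.
have cn0 : c != 0 by near: c; exact: nbhs_dnbhs_neq.
have c1 : `|c| <= Num.min 1 d.
  near: c; apply: nbhs_dnbhs; apply/nbhs_ballP; exists (Num.min 1 d) => /=.
    by rewrite lt_min ltr01.
  by move=> c; rewrite -ball_normE /= sub0r normrN => /ltW.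
move: c1; rewrite le_min => /andP[c1 cd].
have hd : `|c *: (delta_mx i 0 : 'cV[R]_nx)| <= `|c|.
  by rewrite normrZ ler_piMr // norm_delta_mx_le.
have zM : `|z| <= `|z| + 1 by rewrite lerDl.
have zM' : `|c *: delta_mx i 0 + z| <= `|z| + 1.
  apply: le_trans (ler_normD _ _) _; rewrite addrC lerD2l; exact: le_trans hd c1.
have := h T T z (c *: delta_mx i 0 + z) TT TT zM zM'.
rewrite subrr normr0 addrK mul0r addr0 add0r dotZr dot_delta !phiT.
move=> /(_ (ltW d0) (le_trans hd cd)) H.
rewrite /= /GRing.scale /= -(ler_pM2l (_ : 0 < `|c|)) ?normr_gt0 // -normrM mulrBr mulVKf // distrC.
apply: le_trans H _; rewrite mulrC; apply: ler_wpM2r => //; exact: ltW.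
Unshelve. all: by end_near.
Qed.

(** * Verification: the cost of an admissible pair *)

(** On a bounded interval, square-integrability gives integrability of the controls by |a| <= 1 +
    a^2 and of their products by |a b| <= a^2 + b^2; the velocity is affine in the control, with
    coefficients continuous along [y]. *)
Lemma admissible_integrable x0 (y : R -> 'cV[R]_nx) (v : R -> 'cV[R]_nu) :
  admissible P x0 y v ->
  (forall j k, integrable_on `[0, T] (fun s => v s j 0 * v s k 0)) /\
  (forall i, integrable_on `[0, T] (fun s => velocity P (y s) (v s) i 0)).
Proof.
move=> [mv iv2 cy _].
pose D : set (measurableTypeR R) := `[0, T]%classic.
have mD : measurable D by exact: measurable_itv.
have finD : (@lebesgue_measure R D < +oo)%E.
  by rewrite /D lebesgue_measure_itv /=; case: ifP => // _; rewrite -EFinB ltry.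
have ic c : integrable_on D (fun=> c) by exact: integrable_on_cst.
have iv k : integrable_on D (fun s => v s k 0).
  apply: (@integrable_on_le _ D _ (fun s => 1 + (v s k 0) ^+ 2)) => //.
    exact: mv.
    by apply: integrable_onD => //; exact: iv2.
  by move=> s _; exact: normr_le_sqrD1.
have ivv j k : integrable_on D (fun s => v s j 0 * v s k 0).
  apply: (@integrable_on_le _ D _ (fun s => (v s j 0) ^+ 2 + (v s k 0) ^+ 2)) => //.
    by apply: measurable_realfun.measurable_funM; exact: mv.
    by apply: integrable_onD => //; exact: iv2.
  by move=> s _; exact: normrM_le_sqrD.
have Cf : class_C 1 (drift P) by case: A2 => h *; apply: class_C_le h.
have Cg : class_C 1 (input_gain P) by case: A2 => _ h *; apply: class_C_le h.
split => // i.
rewrite (_ : (fun s => _) = fun s => drift P (y s) i 0 + \sum_k input_gain P (y s) i k * v s k 0).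
  apply: integrable_onD => //.
    apply: integrable_on_continuous.
    exact: within_coord (within_ball_lip (ball_lip_C1 Cf) cy).
  apply: (integrable_on_sum mD _).1 => k.
  apply: integrable_on_contM => //.
  exact: within_coord (within_ball_lip (ball_lip_C1 Cg) cy).
by apply/funext => s; rewrite !mxE.
Qed.

Lemma admissible_init x0 (y : R -> 'cV[R]_nx) (v : R -> 'cV[R]_nu) :
  admissible P x0 y v -> y 0 = x0.
Proof.
move=> [_ _ _ yE]; apply/matrixP => i j.
rewrite (ord1 j) (yE 0) ?in_itv /= ?lexx ?(ltW T_gt0) //.
by rewrite set_itv1 Rintegral_set1 addr0.
Qed.

(** The increment of [phi] along [y] is the integral of [w], and completing the square shows that
    [w] is the excess minus the running cost. Since the velocity is only integrable, the chain rule
    is replaced by [Rintegral_partition]. *)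
Lemma verification x0 (y : R -> 'cV[R]_nx) (v : R -> 'cV[R]_nu) :
  (forall z, phi T z = terminal_cost P z) -> admissible P x0 y v ->
  let dev s := v s - feedback P (y s) (gphi s (y s)) in
  let excess s := 2^-1 * ((dev s)^T *m control_weight P *m dev s) 0 0 in
  integrable_on `[0, T] excess /\
  total_cost P y v = phi 0 x0 + \int[@lebesgue_measure R]_(s in `[0, T]) excess s.
Proof.
move=> phiT adm dev excess.
have [ivv ivel] := admissible_integrable adm; have [mv iv2 cy yE] := adm.
pose D : set (measurableTypeR R) := `[0, T]%classic.
have mD : measurable D by exact: measurable_itv.
have finD : (@lebesgue_measure R D < +oo)%E.
  by rewrite /D lebesgue_measure_itv /=; case: ifP => // _; rewrite -EFinB ltry.
have ic c : integrable_on D (fun=> c) by exact: integrable_on_cst.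
have cp := within_gradient cy.
have cyp := within_pair cy cp.
have cmh := within_ball_lip (ball_lip_min_hamiltonian A2) cyp; rewrite /= in cmh.
pose vel s := velocity P (y s) (v s).
have Cl : class_C 1 (state_cost P) by case: A2 => _ _ h *; apply: class_C_le h.
pose w s := dot (gphi s (y s)) (vel s) - min_hamiltonian P (y s) (gphi s (y s)).
(* After integration over a cell, this weight dominates the sum of its length and of the
   displacement of [y] over it. *)
pose g s := 1 + \sum_i `|vel s i 0|.
have idot : integrable_on D (fun s => dot (gphi s (y s)) (vel s)).
  rewrite (_ : (fun s => _) = fun s => \sum_i gphi s (y s) i 0 * vel s i 0).
    apply: (integrable_on_sum mD _).1 => i; apply: integrable_on_contM => //.
    exact: within_coord cp.
  by apply/funext => s; rewrite dotE.
have iw : integrable_on D w.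
  by apply: integrable_onB => //; exact: integrable_on_continuous.
have isum : integrable_on D (fun s => \sum_i `|vel s i 0|).
  by apply: (integrable_on_sum mD _).1 => i; exact: integrable_on_norm.
have ig : integrable_on D g by exact: integrable_onD.
have incr a b i : 0 <= a -> a <= b -> b <= T ->
    y b i 0 - y a i 0 = \int[@lebesgue_measure R]_(s in `]a, b]) vel s i 0.
  move=> a0 ab bT; rewrite (yE b) ?in_itv /= ?(le_trans a0 ab) // (yE a) ?in_itv /= ?a0 ?(le_trans ab bT) //.
  rewrite opprD addrACA subrr add0r; exact: (Rintegral_increment a0 ab bT (ivel i)).
have y0 := admissible_init adm.
have [M M0 hM] := compact_bound (@segment_compact _ 0 T) cy.
(* On a cell, one half of [e] pays for the expansion of [phi] at the left end and the other half for
   freezing [gphi] and the minimal Hamiltonian there. *)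
have chain : phi T (y T) - phi 0 (y 0) = \int[@lebesgue_measure R]_(s in `[0, T]) w s.
  apply: (@Rintegral_partition _ T (fun s => phi s (y s)) w g) => // e e0.
  have e20 : 0 < e / 2 by rewrite divr_gt0.
  have [d1 d10 h1] := unif_diff_phi M e20.
  have [d2 d20 h2] := compact_unif_cont (@segment_compact _ 0 T) cy d10.
  have [d3 d30 h3] := compact_unif_cont (@segment_compact _ 0 T) cp e20.
  have [d4 d40 h4] := compact_unif_cont (@segment_compact _ 0 T) cmh e20.
  exists (Num.min (Num.min d1 d2) (Num.min d3 d4)); first by rewrite !lt_min d10 d20 d30.
  move=> a b a0 ab bT; rewrite !le_min => /andP[/andP[ab1 ab2] /andP[ab3 ab4]].
  have aI : a \in `[0, T] by rewrite in_itv /= a0 (le_trans (ltW ab) bT).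
  have bI : b \in `[0, T] by rewrite in_itv /= bT (le_trans a0 (ltW ab)).
  pose I : set (measurableTypeR R) := `]a, b]%classic.
  have mI : measurable I by exact: measurable_itv.
  have sub f : integrable_on D f -> integrable_on I f by exact: integrable_on_sub_itv.
  have ba0 : 0 <= b - a by rewrite subr_ge0 ltW.
  have IG : \int[@lebesgue_measure R]_(s in I) g s = (b - a) +
      \int[@lebesgue_measure R]_(s in I) \sum_i `|vel s i 0|.
    rewrite (RintegralD mI (sub _ (ic 1)) (sub _ isum)); congr (_ + _).
    by rewrite (Rintegral_itv_cst 1 (ltW ab)) mulr1.
  have dy : `|y b - y a| <= \int[@lebesgue_measure R]_(s in I) \sum_i `|vel s i 0|.
    apply: norm_le_coord => [|i j].
      by apply: Rintegral_ge0 => s _; apply: sumr_ge0.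
    rewrite (ord1 j) !mxE (incr a b i a0 (ltW ab) bT).
    apply: norm_Rintegral_le => //; [exact: sub|exact: sub|].
    by move=> s _; rewrite (bigD1 i) //= lerDl sumr_ge0.
  have H1 := h1 a b (y a) (y b) aI bI (hM a aI) (hM b bI).
  rewrite (ger0_norm ba0) in H1.
  have {}H1 := H1 ab1 _.
  have ybd : `|y b - y a| <= d1 by apply: h2 => //; rewrite ger0_norm.
  have {}H1 := le_trans (H1 ybd) (ler_wpM2l (ltW e20) (lerD (lexx (b - a)) dy)).
  rewrite -IG in H1.
  have idota : integrable_on I (fun s => dot (gphi a (y a)) (vel s)) /\
      \int[@lebesgue_measure R]_(s in I) dot (gphi a (y a)) (vel s) = dot (gphi a (y a)) (y b - y a).
    have [J1 J2] := integrable_on_sum (F := fun i s => gphi a (y a) i 0 * vel s i 0) mI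
      (fun i => integrable_onZ (gphi a (y a) i 0) mI (sub _ (ivel i))).
    have E : (fun s => dot (gphi a (y a)) (vel s)) = fun s => \sum_i gphi a (y a) i 0 * vel s i 0.
      by apply/funext => s; rewrite dotE.
    rewrite E; split => //; rewrite J2 dotE; apply: eq_bigr => i _.
    by rewrite (RintegralZl _ mI (sub _ (ivel i))) !mxE -(incr a b i a0 (ltW ab) bT).
  case: idota => idota dotaE.
  have ima : integrable_on I (fun=> min_hamiltonian P (y a) (gphi a (y a))) by exact: sub.
  have H2 : `|\int[@lebesgue_measure R]_(s in I) w s -
      (dot (gphi a (y a)) (y b - y a) - (b - a) * min_hamiltonian P (y a) (gphi a (y a)))|
      <= e / 2 * \int[@lebesgue_measure R]_(s in I) g s.
    rewrite -dotaE -(Rintegral_itv_cst _ (ltW ab)).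
    rewrite -(RintegralB mI idota ima) -(RintegralB mI (sub _ iw) (integrable_onB mI idota ima)).
    rewrite -(RintegralZl _ mI (sub _ ig)).
    apply: norm_Rintegral_le => //.
    - by apply: integrable_onB => //; [exact: sub|exact: integrable_onB].
    - by apply: integrable_onZ => //; exact: sub.
    move=> s; rewrite /I /= in_itv /= => /andP[as_ sb].
    have sI : s \in `[0, T] by rewrite in_itv /= (le_trans a0 (ltW as_)) (le_trans sb bT).
    have sa : `|s - a| <= b - a by rewrite ger0_norm ?lerD2r // subr_ge0 ltW.
    have K3 := h3 s a sI aI (le_trans sa ab3); have K4 := h4 s a sI aI (le_trans sa ab4).
    rewrite /w (_ : _ - _ = dot (gphi s (y s) - gphi a (y a)) (vel s) -
      (min_hamiltonian P (y s) (gphi s (y s)) - min_hamiltonian P (y a) (gphi a (y a)))); last first.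
      by rewrite dotBl; ring.
    apply: le_trans (ler_normB _ _) _; rewrite /g mulrDr mulr1 addrC; apply: lerD => //.
    rewrite dotE mulr_sumr; apply: le_trans (ler_norm_sum _ _ _) _.
    apply: ler_sum => i _; rewrite normrM; apply: ler_wpM2r => //.
    exact: le_trans (coord_le_norm _ _ _) K3.
  rewrite (_ : _ - _ = (phi b (y b) - phi a (y a) + (b - a) * min_hamiltonian P (y a) (gphi a (y a))
      - dot (gphi a (y a)) (y b - y a)) - (\int[@lebesgue_measure R]_(s in I) w s -
      (dot (gphi a (y a)) (y b - y a) - (b - a) * min_hamiltonian P (y a) (gphi a (y a))))); last first.
    by rewrite /I; ring.
  apply: le_trans (ler_normB _ _) _; apply: le_trans (lerD H1 H2) _.
  by rewrite -mulrDl -splitr.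
have irc : integrable_on D (fun s => running_cost P (y s) (v s)).
  apply: integrable_onD => //.
    by apply: integrable_on_continuous; exact: within_ball_lip (ball_lip_C1_scalar Cl) cy.
  apply: integrable_onZ => //.
  rewrite (_ : (fun s => _) = fun s => \sum_k \sum_j control_weight P j k * (v s j 0 * v s k 0)).
    apply: (integrable_on_sum mD _).1 => k; apply: (integrable_on_sum mD _).1 => j.
    exact: integrable_onZ.
  apply/funext => s; rewrite mxE; apply: eq_bigr => k _; rewrite mxE mulr_suml.
  by apply: eq_bigr => j _; rewrite !mxE; ring.
have exE s : excess s = running_cost P (y s) (v s) + w s.
  have := hamiltonian_square A1 (y s) (gphi s (y s)) (v s).
  rewrite /hamiltonian -/(dot _ _) -/(vel s) -/(dev s) -/(excess s) => H.
  by rewrite /w addrA H addrAC subrr add0r.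
rewrite (_ : excess = fun s => running_cost P (y s) (v s) + w s); last exact/funext.
split; first exact: integrable_onD.
have E : \int[@lebesgue_measure R]_(s in `[0, T]) (running_cost P (y s) (v s) + w s) =
    \int[@lebesgue_measure R]_(s in `[0, T]) running_cost P (y s) (v s) +
    \int[@lebesgue_measure R]_(s in `[0, T]) w s := RintegralD mD irc iw.
by rewrite E -chain y0 /total_cost phiT; ring.
Qed.

(** By [verification] the nonnegative excess has integral zero, so it vanishes almost everywhere,
    and positive definiteness concludes. *)
Lemma ae_feedback x0 (y : R -> 'cV[R]_nx) (v : R -> 'cV[R]_nu) :
  (forall z, phi T z = terminal_cost P z) -> admissible P x0 y v ->
  total_cost P y v <= phi 0 x0 ->
  {ae @lebesgue_measure R, forall s : R, s \in `[0, T] -> v s = feedback P (y s) (gphi s (y s))}.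
Proof.
move=> phiT adm; have [] := verification phiT adm.
set excess := fun s => 2^-1 * _ => iex -> le0.
have ex0 s : 0 <= excess s by rewrite mulr_ge0 ?invr_ge0 ?quad_ge0.
have I0 : \int[@lebesgue_measure R]_(s in `[0, T]) excess s = 0.
  by apply/le_anti/andP; split; [move: le0; rewrite gerDl|apply: Rintegral_ge0].
pose D : set (measurableTypeR R) := `[0, T]%classic.
have mD : measurable D by exact: measurable_itv.
have iE0 : (\int[@lebesgue_measure R]_(s in D) `|(EFin \o excess) s| = 0)%E.
  under eq_integral do rewrite gee0_abs ?lee_fin ?ex0 //.
  have := integrable_fin_num mD iex => /fineK <-.
  by congr EFin.
have := (ae_eq_integral_abs _ mD (measurable_int _ iex)).1 iE0.
apply: ae_imply => s h sD; have [q0] := h sD.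
apply/eqP; rewrite -subr_eq0; apply/eqP/(quad_eq0 A1).
by move/eqP: q0; rewrite mulf_eq0 invr_eq0 pnatr_eq0 /= => /eqP.
Qed.

(** Changing the control on a null set does not alter the integral form of the dynamics; with the
    feedback the velocity becomes continuous, and the trajectory uniformly differentiable. *)
Lemma closed_loop_integral x0 (y : R -> 'cV[R]_nx) (v : R -> 'cV[R]_nu) :
  admissible P x0 y v ->
  {ae @lebesgue_measure R, forall s : R, s \in `[0, T] -> v s = feedback P (y s) (gphi s (y s))} ->
  unif_diff T y (fun s => closed_velocity P (y s) (gphi s (y s))).
Proof.
move=> adm aev; have y0 := admissible_init adm.
have [_ ivel] := admissible_integrable adm.
have [_ _ cy yE] := adm.
have cw : {within `[0, T], continuous (fun s => closed_velocity P (y s) (gphi s (y s)))}.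
  exact: (within_ball_lip (ball_lip_closed_velocity A2) (within_pair cy (within_gradient cy))).
apply: (unif_diff_of_integral cw) => t i tT.
rewrite yE // y0; congr (_ + _).
pose I : set (measurableTypeR R) := `[0, t]%classic.
have mI : measurable I by exact: measurable_itv.
have ID : I `<=` (`[0, T]%classic : set (measurableTypeR R)).
  move=> s; rewrite /I /= !in_itv /= => /andP[-> st] /=.
  by move: tT; rewrite in_itv /= => /andP[_]; exact: le_trans.
have sub f : integrable_on `[0, T] f -> integrable_on I f.
  by apply: integrable_on_sub.
congr fine; apply: (ae_eq_integral _ _ mI).
- exact: measurable_int (sub _ (ivel i)).
- exact: measurable_int (sub _ (integrable_on_continuous (within_coord (i := i) (j := 0) cw))).
- by apply: ae_imply aev => s h sI /=; rewrite h //; exact: (ID _ sI).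
Qed.

(** * Optimality and uniqueness *)

Lemma minimum_principle_optimal x0 (x : R -> 'cV[R]_nx) (u : R -> 'cV[R]_nu) :
  (forall z, phi T z = terminal_cost P z) ->
  minimum_principle P x0 x u -> unique_global_minimum P x0 x u.
Proof.
move=> phiT [q [cx [cq [uE [dx [dq [x0E qT]]]]]]].
have oo_cc t : t \in `]0, T[ -> t \in `[0, T] by exact: subset_itv_oo_cc.
have uF t : t \in `[0, T] -> u t = feedback P (x t) (q t) := @uE t.
have cxq := within_pair cx cq.
have cb := within_ball_lip (ball_lip_closed_velocity A2) cxq; rewrite /= in cb.
have cr := within_ball_lip (ball_lipN (ball_lip_costate_rate A2)) cxq; rewrite /= in cr.
have cf := within_ball_lip (ball_lip_feedback A2) cxq; rewrite /= in cf.
have udx : unif_diff T x (fun t => closed_velocity P (x t) (q t)).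
  by apply: unif_diff_of_derive => // t tT; rewrite /closed_velocity -uF ?oo_cc //; exact: dx.
have udq : unif_diff T q (fun t => - costate_rate P (x t) (q t)).
  by apply: unif_diff_of_derive => // t tT; rewrite /costate_rate -uF ?oo_cc //; exact: dq.
have [Mx Mx0 hMx] := compact_bound (@segment_compact _ 0 T) cx.
have [Mq Mq0 hMq] := compact_bound (@segment_compact _ 0 T) cq.
(* The control [u] is thereby the feedback built on [gphi], so its excess cost vanishes. *)
have qgphi : forall t, t \in `[0, T] -> q t = gphi t (x t).
  apply: (@costate_is_gradient (Num.max Mx Mq) x q) => //.
  - by rewrite le_max ltW.
  - by move=> t tT; rewrite !le_max hMx // hMq ?orbT.
  - by rewrite qT terminal_gradient.
(* Continuity of [u] gives the measurability and square-integrability required of admissible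
   controls. *)
have cu : {within `[0, T], continuous u}.
  apply/within_continuousP => t tT e e0.
  have [d d0 h] := (within_continuousP _ _).1 cf t tT e e0.
  by exists d => // s sT ts; rewrite !uF //; exact: h.
have adm : admissible P x0 x u.
  split => //.
  - move=> i; have := integrable_on_measurable (integrable_on_continuous (within_coord (i := i) (j := 0) cu)).
    exact.
  - move=> i; apply: (@integrable_on_continuous R T (fun t => u t i 0 ^+ 2)).
    have bs : ball_lip (fun B : 'cV[R]_nu => B i 0 * B i 0).
      by apply: ball_lipM; apply: ball_lip_coord; exact: ball_lip_id.
    exact: (within_ball_lip bs cu).
  move=> t i tT; rewrite (integral_of_unif_diff cb udx) // x0E; congr (_ + _).
  apply: eq_Rintegral => s; rewrite inE /= in_itv /= => /andP[s0 st].
  rewrite /closed_velocity -uF // in_itv /= s0.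
  by move: tT; rewrite in_itv /= => /andP[_]; exact: le_trans.
have cost : total_cost P x u = phi 0 x0.
  have [_ ->] := verification phiT adm.
  rewrite (_ : Rintegral _ _ _ = \int[@lebesgue_measure R]_(s in `[0, T]) 0).
    by rewrite Rintegral_cst ?mul0r ?addr0 //; exact: measurable_itv.
  apply: eq_Rintegral => s; rewrite inE /= => sT.
  by rewrite uF // -qgphi // subrr mulmx0 mxE mulr0.
split.
  split => // y v /(verification phiT) [iex ->]; rewrite cost lerDl.
  by apply: Rintegral_ge0 => s _; rewrite mulr_ge0 ?invr_ge0 ?quad_ge0.
(* A second minimizer costs no more than [phi 0 x0], hence is a closed-loop trajectory for
   [gphi]. *)
move=> y v [admy /(_ x u adm)]; rewrite cost => le0.
have aev := ae_feedback phiT admy le0.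
have udy := closed_loop_integral admy aev.
have [_ _ cy _] := admy.
have [My My0 hMy] := compact_bound (@segment_compact _ 0 T) cy.
have yx : forall t, t \in `[0, T] -> y t = x t.
  apply: (@closed_loop_unique (Num.max (Num.max Mx Mq) My) x q y) => //.
  - by rewrite !le_max ltW.
  - by move=> t tT; rewrite !le_max hMx // hMq ?orbT.
  - by move=> t tT; rewrite !le_max hMy ?orbT.
  - by rewrite (admissible_init admy) x0E.
split => //; apply: ae_imply aev => t h tT.
by rewrite h // yx // -qgphi // uF.
Qed.

End ValueFunction.

Unset Implicit Arguments.

Theorem proposition3 (R : realType) (nx nu : nat)
    (P : control_problem R nx nu)
    (T_gt0 : 0 < horizon P)
    (A1 : posdef (control_weight P))
    (A2 : smooth_data P)
    (A3 : exists phi : R -> 'cV[R]_nx -> R, HJB_solution P phi)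
    (x0 : 'cV[R]_nx) (x : R -> 'cV[R]_nx) (u : R -> 'cV[R]_nu) :
  minimum_principle P x0 x u -> unique_global_minimum P x0 x u.
Proof.
(* The continuous extension [phix] of the spatial gradient serves as [gphi], and the attained
   minimum in the HJB equation gives the time derivative. *)
case: A3 => phi [[cphi [dphi [phit [phix [_ [cphix dphix]]]]]] hjb phiT].
apply: (@minimum_principle_optimal R nx nu P T_gt0 A1 A2 phi
  (fun t z => phix (t, z))) => //.
- by rewrite (_ : (fun tz => _) = phix) //; apply/funext => -[].
- by move=> t z tT; have [] := dphix t z tT.
- move=> t z tT; have [_ <-] := dphix t z tT.
  by rewrite -(is_min_hamiltonian A1 (hjb t z tT)) opprK.
Qed.
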